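(* Let $f$ be a solution of the one-dimensional Vlasov-Poisson equation on $\mathbb{T}=\mathbb{R}/\mathbb{Z}$ with background ion density $\rho$, and assume $\int_{\mathbb{T}\times\mathbb{R}}f(x,v,0)\,dv\,dx=1=\int_{\mathbb{T}}\rho(y)\,dy$. Assume that $\rho$ is bounded and that the initial datum $f(\cdot,\cdot,0)$ is smooth and compactly supported in $\mathbb{T}\times\mathbb{R}$. Then there exists a constant $C$, depending only on the initial datum $f(\cdot,\cdot,0)$ and on $\rho$, such that for every $t\ge 0$ $$\|\nabla_{x,v}f(t)\|_{L^\infty}\le C e^{Ct^2}.$$
   Context: The one-dimensional Vlasov-Poisson equation on $\mathbb{T}=\mathbb{R}/\mathbb{Z}$ with background ion density $\rho$ is, for the electron distribution function $f=f(x,v,t)$, $x\in\mathbb{T}$, $v\in\mathbb{R}$, $t\ge 0$, $$\partial_t f(x,v,t)+v\,\partial_x f(x,v,t)-E(x,t)\,\partial_v f(x,v,t)=0,\qquad E(x,t)=\int_0^1K(x,y)\Big[\rho(y)-\int_{-\infty}^{\infty}f(y,v,t)\,dv\Big]dy,$$ with $K(x,y)=y-1$ for $0\le x<y$ and $K(x,y)=y$ for $y<x\le 1$ (so that $\partial_xE=\rho-\int f\,dv$ and $\int_{\mathbb T}E\,dx=0$). The solution is transported by its characteristics: $f(x,v,t)=f(\Phi_t^{-1}(x,v),0)$, where $\Phi_t$ is the flow of $\frac{dx}{dt}=v$, $\frac{dv}{dt}=-E(x,t)$ with $\Phi_0=\mathrm{id}$. $\nabla_{x,v}$ is the gradient in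 $(x,v)$, and $\|\nabla_{x,v} f(t)\|_{L^\infty}$ is the $L^\infty(\mathbb{T}\times\mathbb{R})$ norm at time $t$. *)

(* Defs.v *)
From HB Require Import structures.
From mathcomp Require Import all_boot all_order all_algebra.
From mathcomp Require Import all_classical all_reals all_analysis.

Set Implicit Arguments.
Unset Strict Implicit.
Unset Printing Implicit Defensive.

Import Order.TTheory GRing.Theory Num.Theory.
Import numFieldNormedType.Exports.

Local Open Scope classical_set_scope.
Local Open Scope ring_scope.

(* Functions on the circle R/Z are represented by their 1-periodic lifts to R,
   functions on T x R by functions of z = (x, v) in R * R that are 1-periodic
   in x, and integrals over T x R by integrals over the fundamental domain
   `[0, 1] x R.  A time-dependent density is f : R -> R * R -> R, where
   f t (x, v) is written f(x,v,t) on paper; only times t >= 0 matter. *)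

Notation leb := (@lebesgue_measure _).
Notation leb2 := (leb \x leb)%E.

Section VlasovPoisson.
Context {R : realType}.

Definition periodic_x (h : R * R -> R) : Prop := periodic h (1, 0).

Definition cylinder : set (R * R) := `[0, 1]%classic `*` setT.

(* C^infinity: all iterated directional derivatives exist and are continuous. *)
Definition smooth (V : normedModType R) (h : V -> R) : Prop :=
  forall s : seq V,
    let hs : V -> R := foldr (fun (w : V) (g : V -> R) => 'D_w g) h s in
    continuous hs /\ forall x w : V, derivable hs x w.

(* As T is compact, a closed subset of T x R is compact iff its elements have
   bounded velocities. *)
Definition compactly_supported_v (h : R * R -> R) : Prop :=
  exists M : R, forall x v : R, M < `|v| -> h (x, v) = 0.

Definition fracpart (x : R) : R := x - (Num.floor x)%:~R.

(* The value on the diagonal x = y is irrelevant under the integral in y. *)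
Definition K (x y : R) : R := if x < y then y - 1 else y.

(* The 1-periodic lift of E(., t). *)
Definition efield (rho : R -> R) (f : R -> R * R -> R) (t x : R) : R :=
  (\int[leb]_(y in `[0%R, 1%R])
     (K (fracpart x) y * (rho y - \int[leb]_(v in setT) f t (y, v))))%R.

(* Phi t is the flow (lifted to R * R) of x' = v, v' = - E(t, x) from time 0 to
   time t >= 0. *)
Definition is_char_flow (E : R -> R -> R) (Phi : R -> R * R -> R * R) : Prop :=
  [/\ forall z, Phi 0 z = z,
      forall z, {within [set t : R | 0 <= t], continuous (fun t => Phi t z)} &
      forall (z : R * R) (t : R), 0 < t ->
        is_derive t 1 (fun s : R => (Phi s z).1) (Phi t z).2 /\
        is_derive t 1 (fun s : R => (Phi s z).2) (- E t (Phi t z).1)].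

(* Test functions of (t, (x, v)) on [0, oo[ x T x R. *)
Definition spacetime_test (phi : R * (R * R) -> R) : Prop :=
  [/\ smooth phi,
      forall t, periodic_x (fun z => phi (t, z)) &
      exists M : R, forall t x v : R,
        M < `|t| \/ M < `|v| -> phi (t, (x, v)) = 0].

(* The equation d_t f + v d_x f - E d_v f = 0 with initial datum f 0, in the
   sense of distributions: for rho merely bounded, f t is only Lipschitz. *)
Definition weak_vlasov (E : R -> R -> R) (f : R -> R * R -> R) : Prop :=
  forall phi : R * (R * R) -> R, spacetime_test phi ->
    ((\int[leb]_(t in `[0%R, +oo[) \int[leb2]_(z in cylinder)
        (f t z * ('D_((1, (0, 0)) : R * (R * R)) phi (t, z)
                  + z.2 * 'D_((0, (1, 0)) : R * (R * R)) phi (t, z)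
                  - E t z.1 * 'D_((0, (0, 1)) : R * (R * R)) phi (t, z))))
     + \int[leb2]_(z in cylinder) (f 0 z * phi (0, z)) = 0)%R.

Record vp_solution (rho : R -> R) (f : R -> R * R -> R) : Prop := {
  vp_periodic : forall t : R, 0 <= t -> periodic_x (f t);
  vp_integrable : forall t : R, 0 <= t ->
    leb2.-integrable cylinder (EFin \o f t);
  (* makes the characteristics classical C^1 curves *)
  vp_field_continuous : {within [set p : R * R | 0 <= p.1],
    continuous (fun p : R * R => efield rho f p.1 p.2)};
  vp_equation : weak_vlasov (efield rho f) f;
  vp_transport : exists Phi Psi : R -> R * R -> R * R,
    is_char_flow (efield rho f) Phi /\
    forall t : R, 0 <= t ->
      [/\ cancel (Phi t) (Psi t), cancel (Psi t) (Phi t) &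
          forall z, f t z = f 0 (Psi t z)] }.

Definition test_function (psi : R * R -> R) : Prop :=
  smooth psi /\ compact (closure [set z | psi z != 0]).

Definition loc_integrable (g : R * R -> R) : Prop :=
  forall A : set (R * R), compact A -> leb2.-integrable A (EFin \o g).

(* g is the distributional derivative of u in the direction w. *)
Definition weak_derivative (w : R * R) (u g : R * R -> R) : Prop :=
  loc_integrable g /\
  forall psi : R * R -> R, test_function psi ->
    (\int[leb2]_(z in setT) (u z * 'D_w psi z)
     = - \int[leb2]_(z in setT) (g z * psi z))%R.

Definition weak_gradient (u : R * R -> R) (g : R * R -> R * R) : Prop :=
  [/\ measurable_fun setT g,
      weak_derivative (1, 0) u (fst \o g) &
      weak_derivative (0, 1) u (snd \o g)].

(* On R * R the library norm `|_| is the max norm. *)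
Definition eucl (p : R * R) : R := Num.sqrt (p.1 ^+ 2 + p.2 ^+ 2).

(* The L^oo norm over T x R: the gradient of an x-periodic function is
   x-periodic, so the essential supremum may be taken over R * R. *)
Definition Linfty_norm (g : R * R -> R * R) : \bar R :=
  Lnorm leb2 +oo%E (fun z => (eucl (g z))%:E).

End VlasovPoisson.

(* Main.v *)
Require Import Defs.
From HB Require Import structures.
From mathcomp Require Import all_boot all_order all_algebra.
From mathcomp Require Import all_classical all_reals all_analysis.
From mathcomp Require Import measurable_realfun ess_sup_inf.
From mathcomp Require Import ring lra.
Import Order.TTheory GRing.Theory Num.Theory.
Import numFieldNormedType.Exports.
Set Implicit Arguments.
Unset Strict Implicit.
Unset Printing Implicit Defensive.
Local Open Scope classical_set_scope.
Local Open Scope ring_scope.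

(** Characteristics that are close to each other separate at a rate governed by
    the Lipschitz constant of E(t, .): when it is at most L on [0, t], the
    backward flow expands distances by at most exp ((1 + L) t / 2)
    [trajectory_gronwall].  Since f is constant along characteristics, f t
    inherits a Lipschitz bound of that form, and a bound exp (C t^2) follows as
    soon as L grows at most linearly with t.

    The x-derivative of E is rho minus the electron density.  The values of f
    stay bounded by those of f 0 and velocities change by at most t sup |E|, so
    the density is at most of order 1 + t sup |E| [efield_lip].  Everything
    therefore rests on a bound of E that is uniform in time.  From the formula
    for E, |E| <= sup |rho| + ||f t||_1, so what is needed is that the L^1 norm
    of f does not grow [efield_apriori_bound].

    As f 0 may change sign this is more than conservation of the total mass: the
    flow has to preserve volumes.  The field is only Lipschitz in x, so instead
    of a Jacobian the proof uses the semi-implicit Euler scheme run backwards.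
    Each of its steps is a kick followed by a drift, that is, two shears, and
    shears preserve integrals over the cylinder by Fubini's theorem and
    translation invariance [integral_kick, integral_drift].  The scheme converges
    pointwise to the backward flow [backward_euler_cvg], and Fatou's lemma bounds
    the L^1 norm of f t by that of f 0 [transported_L1].  The convergence proof
    needs some Lipschitz bound of E in x, with no control of its size; it comes
    from the maximum of |E| over [0, t] x [0, 1].

    It remains to see that a function that is L-Lipschitz in each variable has a
    bounded weak gradient [lip_weak_gradient].  In one variable, F + L x is the
    distribution function of a measure dominated by 2 L times Lebesgue measure,
    so the Radon-Nikodym and Lebesgue differentiation theorems make F an
    indefinite integral of its almost everywhere derivative.  This gives
    integration by parts on every line parallel to an axis, and Fubini's theorem
    integrates over the lines.  The weak derivative is represented by the upper
    limit of the difference quotients, which is measurable on the plane. *)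

(** * Lipschitz functions of one variable are indefinite integrals *)

Definition lip_with {R : realType} (L : R) (F : R -> R) : Prop :=
  forall x y, `|F x - F y| <= L * `|x - y|.

Lemma lip_with_continuous {R : realType} (L : R) (F : R -> R) :
  lip_with L F -> continuous F.
Proof.
move=> lipF x; apply/cvgrPdist_le => e e0.
have L0 : 0 <= L.
  by have := lipF 1 0; rewrite subr0 normr1 mulr1; apply: le_trans.
have LL0 : 0 < L + 1 by apply: ltr_wpDl.
near=> y; apply: (le_trans (lipF x y)).
have : `|x - y| <= e / (L + 1).
  by near: y; apply: cvgr_dist_le => //; exact: divr_gt0.
rewrite ler_pdivlMr// => h; apply: le_trans h.
by rewrite mulrC ler_wpM2l// lerDl.
Unshelve. all: by end_near. Qed.

(** F + L x and L x - F are both nondecreasing, and their Stieltjes measures add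
    up to 2 L times Lebesgue measure: a Lebesgue null set is null for each. *)
Lemma lip_stieltjes_dominated {R : realType} (L : R) (F : R -> R) :
  0 < L -> lip_with L F ->
  exists mu : {measure set (measurableTypeR R) -> \bar R},
    (forall a b, a <= b -> mu `]a, b]%classic = (F b - F a + L * (b - a))%:E) /\
    mu `<< leb.
Proof.
move=> L0 lipF.
have cF := lip_with_continuous lipF.
pose P := fun x => F x + L * x; pose Q := fun x => L * x - F x.
have ndP : nondecreasing P.
  move=> x y xy; rewrite /P.
  have := lipF x y; rewrite ler_norml => /andP[_].
  by rewrite distrC ger0_norm ?subr_ge0//; nra.
have ndQ : nondecreasing Q.
  move=> x y xy; rewrite /Q.
  have := lipF y x; rewrite ler_norml => /andP[_].
  by rewrite ger0_norm ?subr_ge0//; nra.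
have rP : right_continuous P.
  apply: right_continuousW => x.
  apply: (@continuousD _ _ _ F (fun x => L * x)); first exact: cF.
  exact: mulrl_continuous.
have rQ : right_continuous Q.
  apply: right_continuousW => x.
  apply: (@continuousB _ _ _ (fun x => L * x) F); last exact: cF.
  exact: mulrl_continuous.
pose cP : cumulative R R := HB.pack P (isCumulative.Build R _ R P ndP rP).
pose cQ : cumulative R R := HB.pack Q (isCumulative.Build R _ R Q ndQ rQ).
have wE (f : cumulative R R) (a b : R) : a <= b ->
    lebesgue_stieltjes_measure f `]a, b]%classic = (f b - f a)%:E.
  move=> ab; rewrite /lebesgue_stieltjes_measure /measure_extension/=.
  rewrite measurable_mu_extE/=; last exact: is_ocitv.
  by rewrite wlength_itv_bnd.
pose muP : {measure set (measurableTypeR R) -> \bar R} := lebesgue_stieltjes_measure cP.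
pose muQ : {measure set (measurableTypeR R) -> \bar R} := lebesgue_stieltjes_measure cQ.
exists muP; split.
  move=> a b ab; rewrite [LHS](wE cP)//=; congr EFin; rewrite /P; ring.
have c0 : 0 <= (2 * L)^-1 by rewrite invr_ge0 mulr_ge0// ltW.
pose c : {nonneg R} := NngNum c0.
have sumE A : measurable A -> leb A = mscale c (measure_add muP muQ) A.
  apply: lebesgue_measure_unique => X -[[a b] _ <-] /=.
  transitivity (c%:num%:E * (muP `]a, b]%classic + muQ `]a, b]%classic))%E; last first.
    by rewrite -measure_addE.
  have [ab|ba] := leP a b; last first.
    by rewrite set_itv_ge ?bnd_simp -?leNgt ?(ltW ba)// !measure0 adde0 mule0.
  have -> : leb `]a, b]%classic = (b - a)%:E.
    rewrite lebesgue_measure_itv/= lte_fin; case: ltP => [//|ba].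
    by rewrite (@le_anti _ _ a b) ?ab// subrr.
  have -> : muP `]a, b]%classic = (P b - P a)%:E by exact: (wE cP).
  have -> : muQ `]a, b]%classic = (Q b - Q a)%:E by exact: (wE cQ).
  rewrite -EFinD -EFinM /P /Q; congr EFin.
  transitivity ((2 * L)^-1 * (2 * L * (b - a))); last (by congr (_ * _); ring).
  by rewrite mulKf// mulf_neq0 ?gt_eqF.
apply/null_content_dominatesP => A mA A0.
have : mscale c (measure_add muP muQ) A = 0%E by rewrite -sumE.
have -> : mscale c (measure_add muP muQ) A = (c%:num%:E * (muP A + muQ A))%E.
  by rewrite -measure_addE.
move=> /eqP; rewrite mule_eq0 eqe gt_eqF ?invr_gt0 ?mulr_gt0//= padde_eq0
  ?measure_ge0//.
by move=> /andP[/eqP].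
Qed.

(** The density g is the Radon-Nikodym derivative of the Stieltjes measure of
    F + L x, restricted to ]a, b] to make it finite, minus L. *)
Lemma lip_primitive {R : realType} (L : R) (F : R -> R) (a b : R) :
  0 < L -> lip_with L F -> a < b ->
  exists g : R -> R, leb.-integrable setT (EFin \o g) /\
    forall x, a <= x <= b -> F x - F a = (\int[leb]_(y in `]a, x]) g y)%R.
Proof.
move=> L0 lipF ab.
have [mu [muE mu_leb]] := lip_stieltjes_dominated L0 lipF.
pose D : set (measurableTypeR R) := `]a, b]%classic.
have mD : measurable D by exact: measurable_itv.
have muD : (mu D < +oo)%E by rewrite muE ?ltW// ltry.
pose nu : {finite_measure set (measurableTypeR R) -> \bar R} := mfrestr mD muD.
have nuleb : nu `<< (leb : set (measurableTypeR R) -> \bar R).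
  apply/null_content_dominatesP => A mA A0.
  have /null_content_dominatesP muA := mu_leb.
  apply/eqP; rewrite eq_le measure_ge0 andbT.
  rewrite -(muA _ mA A0)/= /mfrestr/= /mrestr le_measure ?inE//.
  exact: measurableI.
have [g [g0 gfin gint nuE]] := radon_nikodym_sigma_finite nuleb.
pose h x := fine (g x) - L * \1_D x.
have inth1 : leb.-integrable setT (EFin \o (fine \o g)).
  by apply: eq_integrable gint => // x _ /=; rewrite fineK.
have inth2 : leb.-integrable setT (EFin \o (fun x => L * \1_D x)).
  under [X in _.-integrable _ X]eq_fun do rewrite /= EFinM.
  by apply: integrableZl => //; exact: integrable_indic_itv.
exists h; split.
  by apply: eq_integrable (integrableB measurableT inth1 inth2) => // x _.
move=> x /andP[ax xb].
have mx : measurable (`]a, x]%classic : set (measurableTypeR R))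
  by exact: measurable_itv.
have xD : `]a, x]%classic `<=` D.
  by apply: subset_itvl; rewrite bnd_simp.
rewrite /h RintegralB//; [|exact: integrableS inth1|exact: integrableS inth2].
have -> : (\int[leb]_(y in `]a, x]) fine (g y) = F x - F a + L * (x - a))%R.
  rewrite /Rintegral; under eq_integral do rewrite fineK//.
  by rewrite -nuE// /nu/= /mfrestr/= /mrestr setIidl// muE.
suff -> : (\int[leb]_(y in `]a, x]) (L * \1_D y) = L * (x - a))%R by rewrite addrK.
rewrite RintegralZl//; last first.
  apply: (integrableS measurableT) => //; exact: integrable_indic_itv.
congr (_ * _).
rewrite /Rintegral integral_indic// (setIidr xD).
suff E : leb `]a, x]%classic = (x - a)%:E by exact: (congr1 fine E).
rewrite lebesgue_measure_itv/= lte_fin; case: ltP => // xa.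
by rewrite (@le_anti _ _ a x) ?ax// subrr.
Qed.

Definition difference_quotient {R : realType} (F : R -> R) (x : R) (n : nat) : R :=
  n.+1%:R * (F (x + n.+1%:R^-1) - F x).

(** A representative of the derivative that is defined everywhere and, as an
    upper limit of a sequence, depends measurably on parameters of F. *)
Definition upper_slope {R : realType} (F : R -> R) (x : R) : R :=
  limn_sup (difference_quotient F x).

Lemma difference_quotient_bound {R : realType} (L : R) (F : R -> R) x n :
  lip_with L F -> `|difference_quotient F x n| <= L.
Proof.
move=> /(_ (x + n.+1%:R^-1) x); rewrite addrAC subrr add0r => lF.
rewrite /difference_quotient normrM ger0_norm// -ler_pdivlMl//.
by rewrite mulrC; apply: le_trans lF _; rewrite ger0_norm ?invr_ge0.
Qed.

Lemma upper_slope_bound {R : realType} (L : R) (F : R -> R) x :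
  lip_with L F -> `|upper_slope F x| <= L.
Proof.
move=> lF; rewrite /upper_slope.
have qL n := difference_quotient_bound x n lF.
have ub : has_ubound (range (difference_quotient F x)).
  by exists L => _ [n _ <-]; rewrite (le_trans (ler_norm _)).
have lb : has_lbound (range (difference_quotient F x)).
  by exists (- L) => _ [n _ <-]; have := qL n; rewrite ler_norml => /andP[].
have sL n : - L <= sups (difference_quotient F x) n <= L.
  apply/andP; split.
    apply: (@le_trans _ _ (difference_quotient F x n)).
      by have := qL n; rewrite ler_norml => /andP[].
    apply: ub_le_sup; last by exists n => /=.
    by case: ub => M hM; exists M => _ [k _ <-]; apply: hM; exists k.
  apply: ge_sup; first by exists (difference_quotient F x n); exists n => /=.
  by move=> _ [k _ <-]; rewrite (le_trans (ler_norm _)).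
have cs : cvgn (sups (difference_quotient F x)).
  by apply/cvg_ex; eexists; apply: cvg_sups_inf.
rewrite ler_norml; apply/andP; split.
  by apply: limr_ge => //; apply: nearW => n; case/andP: (sL n).
by apply: limr_le => //; apply: nearW => n; case/andP: (sL n).
Qed.

Lemma upper_slope_derive {R : realType} (F : R -> R) x :
  derivable F x 1 -> upper_slope F x = 'D_1 F x.
Proof.
move=> dF; rewrite /upper_slope.
suff qd : difference_quotient F x @ \oo --> 'D_1 F x by rewrite (cvg_limn_inf_sup qd).
have {}dF : (h^-1 *: ((F \o shift x) (h *: 1) - F x)) @[h --> 0^'] --> 'D_1 F x := dF.
have := (@cvgr_dnbhsP R (fun h => h^-1 *: ((F \o shift x) (h *: 1) - F x))
  0 ('D_1 F x)).1 dF
  (fun n => n.+1%:R^-1).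
have h0 : (forall n, n.+1%:R^-1 != 0 :> R) /\ (n.+1%:R^-1 : R) @[n --> \oo] --> (0 : R).
  by split; [move=> n; rewrite invr_eq0 pnatr_eq0|exact: cvg_harmonic].
move=> /(_ h0); apply: cvg_trans; apply: near_eq_cvg; apply: nearW => n.
by rewrite /difference_quotient /= invrK [_%:A]mulr1 [x + _]addrC.
Qed.

Lemma measurable_upper_slope {d} {T : measurableType d} {R : realType}
    (L : R) (u : T -> R -> R) (X : T -> R) :
  (forall t, lip_with L (u t)) ->
  (forall c, measurable_fun setT (fun t => u t (X t + c))) ->
  measurable_fun setT (fun t => upper_slope (u t) (X t)).
Proof.
move=> lu mu; apply: (@measurable_fun_limn_sup _ _ _ _
  (fun n t => difference_quotient (u t) (X t) n)).
- move=> t _; exists L => _ [n _ <-].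
  exact: le_trans (ler_norm _) (difference_quotient_bound _ _ (lu t)).
- move=> t _; exists (- L) => _ [n _ <-].
  by have := difference_quotient_bound (X t) n (lu t); rewrite ler_norml => /andP[].
- move=> n; apply: measurable_funM => //; apply: measurable_funB => //.
  by have := mu 0; under eq_fun do rewrite addr0.
Qed.

(** By Lebesgue's differentiation theorem the density of lip_primitive is almost
    everywhere the derivative of F, hence the upper slope. *)
Lemma lip_ae_derivable_itv {R : realType} (L : R) (F : R -> R) (a b : R) :
  0 < L -> lip_with L F -> a < b ->
  {ae leb, forall x, a < x < b -> derivable F x 1} /\
  (\int[leb]_(x in `[a, b]) upper_slope F x = F b - F a)%R.
Proof.
move=> L0 lF ab; have [g [intg gE]] := lip_primitive L0 lF ab.
have mU : measurable_fun setT (upper_slope F).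
  apply: (@measurable_upper_slope _ _ R L (fun=> F) id) => // c.
  apply: continuous_measurable_fun => x.
  apply: continuous_comp; last exact: (lip_with_continuous lF).
  by apply: continuousD; [exact: cvg_id|exact: cvg_cst].
have key : {ae leb, forall x, a < x < b -> derivable F x 1 /\ 'D_1 F x = g x}.
  have := @FTC1 R g (BRight a) _ _.
  have ig y : leb.-integrable [set` Interval (BRight a) (BRight y)] (EFin \o g).
    by apply: (integrableS measurableT) => //; exact: measurable_itv.
  have lg : locally_integrable setT g.
    by have := integrable_locally measurableT intg; rewrite patch_setT.
  move=> /(_ ig lg); apply: (@filterS _ _ (ae_filter_ringOfSetsType leb))
    => x /= h /andP[ax xb].
  have [dH H'] := h ax.
  have FH : \forall y \near x, F a + (\int[leb]_(t in `]a, y]) g t)%R = F y.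
    near=> y; rewrite -gE; first by rewrite addrC subrK.
    apply/andP; split.
      by near: y; exact: lt_le_nbhsr.
    by near: y; exact: lt_le_nbhsl.
  have dI : is_derive x (1 : R) (fun y => \int[leb]_(t in `]a, y]) g t)%R (g x).
    by apply: DeriveDef dH _; rewrite -derive1E.
  have D : is_derive x (1 : R) (fun y => F a + (\int[leb]_(t in `]a, y]) g t)%R)
    (0 + g x)
    := is_deriveD (is_derive_cst (F a) x 1) dI.
  rewrite add0r in D.
  split; first by apply: near_eq_derivable FH _; apply: ex_derive.
  by rewrite -(near_eq_derive _ FH) derive_val.
split; first by apply: (@filterS _ _ (ae_filter_ringOfSetsType leb)) key => x /= h /h[].
rewrite [RHS]gE ?lexx ?ltW//.
have mab : measurable (`]a, b[%classic : set R) by exact: measurable_itv.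
transitivity (\int[leb]_(x in `]a, b[) upper_slope F x)%R.
  rewrite /Rintegral integral_itv_bndoo//.
  by apply/measurable_EFinP; exact: measurable_funTS.
transitivity (\int[leb]_(x in `]a, b[) g x)%R; last first.
  rewrite /Rintegral; congr fine; apply/esym/integral_itv_bndoo.
  exact: measurable_funTS (measurable_int _ intg).
rewrite /Rintegral; congr fine; apply: ae_eq_integral => //.
- by apply/measurable_EFinP; apply: measurable_funTS.
- exact: measurable_funTS (measurable_int _ intg).
apply: (@filterS _ _ (ae_filter_ringOfSetsType leb)) key => x /= h;
  rewrite in_itv/= => /h [dF <-].
by rewrite upper_slope_derive.
Unshelve. all: by end_near. Qed.

(** * Integration by parts for Lipschitz functions of one variable *)

Lemma lip_with_ge0 {R : realType} (L : R) (F : R -> R) : lip_with L F -> 0 <= L.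
Proof.
by move=> /(_ 1 0); rewrite subr0 normr1 mulr1; apply: le_trans.
Qed.

Lemma lip_withM {R : realType} (L L' B P : R) (u psi : R -> R) :
  lip_with L u -> lip_with L' psi ->
  (forall x, `|u x| <= B) -> (forall x, `|psi x| <= P) ->
  lip_with (L * P + B * L' + 1) (u \* psi).
Proof.
move=> lu lp uB pP x y /=.
have L0 := lip_with_ge0 lu; have L'0 := lip_with_ge0 lp.
have -> : u x * psi x - u y * psi y = (u x - u y) * psi x + u y * (psi x - psi y)
  by ring.
apply: le_trans (ler_normD _ _) _; rewrite !normrM !mulrDl mul1r.
rewrite -[leLHS]addr0; apply: lerD => //; apply: lerD.
  rewrite mulrAC; apply: ler_pM => //.
rewrite -mulrA; exact: ler_pM.
Qed.

Lemma bounded_integrable {d} {T : measurableType d} {R : realType}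
    (mu : {measure set T -> \bar R}) (A : set T) (h : T -> R) (C : R) :
  measurable A -> (mu A < +oo)%E -> measurable_fun A h ->
  (forall x, A x -> `|h x| <= C) -> mu.-integrable A (EFin \o h).
Proof.
move=> mA muA mh hC; apply: measurable_bounded_integrable => //.
exists C; split; first exact: num_real.
by move=> x Cx y Ay; apply: le_trans (hC _ Ay) (ltW Cx).
Qed.

Lemma measurable_upper_slope_lip {R : realType} (L : R) (F : R -> R) :
  lip_with L F -> measurable_fun setT (upper_slope F).
Proof.
move=> lF; apply: (@measurable_upper_slope _ _ R L (fun=> F) id) => // c.
apply: continuous_measurable_fun => x.
apply: continuous_comp; last exact: (lip_with_continuous lF).
by apply: continuousD; [exact: cvg_id|exact: cvg_cst].
Qed.

Lemma derive_eq0_outside {R : realType} (psi : R -> R) (M x : R) :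
  (forall y, M < `|y| -> psi y = 0) -> M < `|x| -> 'D_1 psi x = 0.
Proof.
move=> p0 Mx; rewrite -(@derive_cst R R R 0 x 1).
apply: near_eq_derive; near=> y; rewrite p0//.
near: y; apply: (cvgr_norm_gt (f := id) x) => //; exact: cvg_id.
Unshelve. all: by end_near. Qed.

(** The product of u and psi is Lipschitz and vanishes at both ends of a large
    interval, so its almost everywhere derivative has integral zero there. *)
Lemma lip_integration_by_parts {R : realType} (L L' B P M : R) (u psi : R -> R) :
  lip_with L u -> lip_with L' psi ->
  (forall x, `|u x| <= B) -> (forall x, `|psi x| <= P) ->
  (forall x, derivable psi x 1) -> (forall x, M < `|x| -> psi x = 0) ->
  (\int[leb]_x (u x * 'D_1 psi x)%:E =
   \int[leb]_x (- (upper_slope u x * psi x))%:E)%E.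
Proof.
move=> lu lp uB pP dp p0.
have L0 := lip_with_ge0 lu.
pose w := u \* psi.
have lw : lip_with (L * P + B * L' + 1) w by exact: lip_withM.
have lu1 : lip_with (L + 1) u.
  by move=> x y; apply: le_trans (lu x y) _; rewrite ler_wpM2r// lerDl.
have B0 : 0 <= B by apply: le_trans (uB 0).
have P0 : 0 <= P by apply: le_trans (pP 0).
have W0 : 0 < L * P + B * L' + 1.
  by rewrite ltr_wpDl// addr_ge0// mulr_ge0// (lip_with_ge0 lp).
(* psi vanishes in a neighbourhood of the endpoints - N and N *)
pose N : R := `|M| + 1.
have MN : M < N by rewrite /N ltr_pwDr// ler_norm.
have N0 : - N < N by rewrite gtrN// /N ltr_wpDl.
pose I : set R := `[- N, N]%classic.
pose J : set R := `]- N, N[%classic.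
have outI x : ~ I x -> M < `|x|.
  rewrite /I/= in_itv/= -ler_norml => /negP; rewrite -ltNge.
  exact: lt_trans.
have Dp0 x : M < `|x| -> 'D_1 psi x = 0 by exact: derive_eq0_outside.
have [aeu _] := lip_ae_derivable_itv (ltr_wpDl L0 (ltr01)) lu1 N0.
have [_] := lip_ae_derivable_itv W0 lw N0.
have -> : w N - w (- N) = 0.
  have N1 : M < `|N| by rewrite ger0_norm// /N addr_ge0.
  by rewrite /w/= (p0 N)// (p0 (- N)) ?normrN// !mulr0 subr0.
have mI : measurable I by exact: measurable_itv.
have muI : (leb I < +oo)%E.
  by rewrite lebesgue_measure_itv/= lte_fin N0 -EFinB ltry.
have mu : measurable_fun setT u by apply: continuous_measurable_fun;
  exact: (lip_with_continuous lu).
have mp : measurable_fun setT psi by apply: continuous_measurable_fun;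
  exact: (lip_with_continuous lp).
have mDp : measurable_fun setT (fun x => 'D_1 psi x).
  under eq_fun do rewrite -upper_slope_derive//.
  exact: measurable_upper_slope_lip lp.
have mS : measurable_fun setT (upper_slope u) by exact: measurable_upper_slope_lip lu.
have Dp x : `|'D_1 psi x| <= L' by rewrite -upper_slope_derive//;
  exact: upper_slope_bound.
pose h1 x := upper_slope u x * psi x; pose h2 x := u x * 'D_1 psi x.
have mh1 : measurable_fun setT h1 by exact: measurable_funM.
have mh2 : measurable_fun setT h2 by exact: measurable_funM.
have i1 : leb.-integrable I (EFin \o h1).
  apply: (@bounded_integrable _ _ _ _ _ _ (L * P)) => //; first exact: measurable_funTS.
  by move=> x _; rewrite normrM ler_pM// upper_slope_bound.
have i2 : leb.-integrable I (EFin \o h2).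
  apply: (@bounded_integrable _ _ _ _ _ _ (B * L')) => //;
    first exact: measurable_funTS.
  by move=> x _; rewrite normrM ler_pM.
have -> : (\int[leb]_(x in I) upper_slope w x = \int[leb]_(x in I) (h1 x + h2 x))%R.
  rewrite /Rintegral; congr fine.
  transitivity (\int[leb]_(x in J) (upper_slope w x)%:E)%E.
    by apply: integral_itv_bndoo; apply/measurable_EFinP/measurable_funTS;
      exact: measurable_upper_slope_lip lw.
  transitivity (\int[leb]_(x in J) (h1 x + h2 x)%:E)%E; last first.
    by apply/esym/integral_itv_bndoo; apply/measurable_EFinP/measurable_funTS;
      exact: measurable_funD.
  apply: ae_eq_integral => //.
  - exact: (measurable_itv `]- N, N[).
  - by apply/measurable_EFinP/measurable_funTS; exact: measurable_upper_slope_lip lw.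
  - by apply/measurable_EFinP/measurable_funTS; exact: measurable_funD.
  apply: (@filterS _ _ (ae_filter_ringOfSetsType leb)) aeu => x /= h.
  rewrite /J/= in_itv/= => /h du; congr EFin.
  have [dw wE] : is_derive x (1 : R) w (u x *: 'D_1 psi x + psi x *: 'D_1 u x)
    := is_deriveM (derivableP du) (derivableP (dp x)).
  rewrite (upper_slope_derive dw) wE /h1 /h2 (upper_slope_derive du).
  by rewrite addrC [psi x *: _]mulrC.
rewrite RintegralD// => /eqP; rewrite addrC addr_eq0 => /eqP E.
have restr (h : R -> R) : (forall x, M < `|x| -> h x = 0) ->
    (\int[leb]_x (h x)%:E = \int[leb]_(x in I) (h x)%:E)%E.
  move=> h0; rewrite [RHS]integral_mkcond; apply: eq_integral => x _.
  by rewrite patchE; case: ifPn => // /negP xI; rewrite h0//; apply: outI => Ix;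
    apply: xI; rewrite inE.
rewrite restr; last by move=> x Mx; rewrite Dp0// mulr0.
rewrite [RHS]restr; last by move=> x Mx; rewrite p0// mulr0 oppr0.
rewrite -[LHS]fineK ?integrable_fin_num//.
have i1' : leb.-integrable I (EFin \o (fun x => - h1 x)).
  apply: (@bounded_integrable _ _ _ _ _ _ (L * P)) => //.
    by apply: measurable_funTS; exact: measurableT_comp mh1.
  by move=> x _; rewrite normrN normrM ler_pM// upper_slope_bound.
rewrite -[RHS]fineK ?integrable_fin_num//; congr EFin.
rewrite -/(Rintegral leb I h2) E -[RHS]/(\int[leb]_(x in I) - h1 x)%R.
under [RHS]eq_Rintegral do rewrite -mulN1r.
by rewrite RintegralZl// mulN1r.
Qed.

(** * Measurability in the plane *)

(** An open set is the union of the countably many squares with rational centre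
    and radius 1 / (k + 1) that it contains. *)
Lemma open_measurable_plane {R : realType} (U : set (R * R)) : open U -> measurable U.
Proof.
move=> oU.
pose box (i : rat * rat * nat) : set (R * R) :=
  ball (ratr i.1.1 : R) i.2.+1%:R^-1 `*` ball (ratr i.1.2 : R) i.2.+1%:R^-1.
pose F i := if pselect (box i `<=` U) then box i else set0.
have -> : U = \bigcup_i F i.
  apply/seteqP; split=> [[x y] Uxy|z [i _]]; last first.
    by rewrite /F; case: pselect => // h /h.
  have [e /= e0 xyU] : nbhs_ball (x, y) U by rewrite nbhs_ballE; exact: open_nbhs_nbhs.
  have e20 : 0 < e / 2 by rewrite divr_gt0.
  have [k _ /(_ k (leqnn _)) /= ke] := near_infty_natSinv_lt (PosNum e20).
  have k0 : 0 < k.+1%:R^-1 :> R by rewrite invr_gt0.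
  have near_rat (z : R) : exists q : rat, `|ratr q - z| < k.+1%:R^-1.
    have [|q /itvP qz] := @rat_in_itvoo R (z - k.+1%:R^-1) (z + k.+1%:R^-1).
      by rewrite ltrD2l gtrN.
    by exists q; rewrite ltr_distl !qz.
  have [p px] := near_rat x; have [q qy] := near_rat y.
  exists (p, q, k) => //; rewrite /F; case: pselect => [h|]; first by split.
  case=> -[x' y'] [/= px' qy']; apply: xyU; split => /=.
    rewrite /ball/= (splitr e) -(subrKA (ratr p)) (le_lt_trans (ler_normD _ _))//.
    by rewrite ltrD// ?(lt_trans _ ke)// distrC.
  rewrite /ball/= (splitr e) -(subrKA (ratr q)) (le_lt_trans (ler_normD _ _))//.
  by rewrite ltrD// ?(lt_trans _ ke)// distrC.
apply: countable_bigcupT_measurable => // i.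
rewrite /F; case: pselect => h /=; last exact: measurable0.
by apply: measurableX; exact: measurable_ball.
Qed.

Lemma closed_measurable_plane {R : realType} (A : set (R * R)) : closed A ->
  measurable A.
Proof.
by move=> cA; rewrite -[A]setCK; apply: measurableC; apply: open_measurable_plane;
  exact: closed_openC.
Qed.

Lemma continuous_measurable_plane {R : realType} (h : R * R -> R) :
  continuous h -> measurable_fun setT h.
Proof.
move=> ch; apply: (measurability _ (RGenOInfty.measurableE R)) => //.
move=> _ [_ [x ->] <-]; rewrite setTI; apply: open_measurable_plane.
by apply: open_comp; [move=> z _; exact: ch|exact: interval_open].
Qed.

Lemma compact_plane_bounded {R : realType} (A : set (R * R)) : compact A ->
  exists2 M : R, 0 < M & forall z, A z -> `|z.1| <= M /\ `|z.2| <= M.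
Proof.
move=> /compact_bounded [M [_ hM]].
exists (`|M| + 1); first by rewrite ltr_wpDl.
have lM : M < `|M| + 1 by rewrite ltr_pwDr// ler_norm.
by move=> z Az; have := hM _ lM z Az; rewrite /= prod_normE/= ge_max => /andP[].
Qed.

Lemma compact_measurable_plane {R : realType} (A : set (R * R)) :
  compact A -> measurable A.
Proof.
by move=> cA; apply: closed_measurable_plane; apply: compact_closed => //;
  exact: norm_hausdorff.
Qed.

Lemma lebesgue_rectangle {R : realType} (a b c d : R) :
  (leb2 (`[a, b]%classic `*` `[c, d]%classic : set (R * R)) < +oo)%E.
Proof.
rewrite product_measure1E//=.
rewrite !lebesgue_measure_itv/= !lte_fin; case: ifP => _; case: ifP => _;
 by rewrite -?EFinB ?mule0 ?mul0e ?ltry// -EFinM ltry.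
Qed.

Lemma compact_finite_plane {R : realType} (A : set (R * R)) :
  compact A -> (leb2 A < +oo)%E.
Proof.
move=> cA; have [M M0 AM] := compact_plane_bounded cA.
apply: le_lt_trans (lebesgue_rectangle (- M) M (- M) M).
apply: le_measure; rewrite ?inE//; first exact: compact_measurable_plane.
  by apply: measurableX; exact: measurable_itv.
by move=> z /AM [h1 h2]; split => /=; rewrite in_itv/= -ler_norml.
Qed.

Lemma continuous_pair {T U V : topologicalType} (f : T -> U) (g : T -> V) :
  continuous f -> continuous g -> continuous (fun z => (f z, g z)).
Proof. by move=> cf cg z; apply: cvg_pair; [exact: cf|exact: cg]. Qed.

Lemma continuous_fst {T U : topologicalType} : continuous (@fst T U).
Proof. by move=> z; exact: cvg_fst. Qed.

Lemma continuous_snd {T U : topologicalType} : continuous (@snd T U).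
Proof. by move=> z; exact: cvg_snd. Qed.

Lemma continuous_add {T : topologicalType} {R : realType} (f g : T -> R) :
  continuous f -> continuous g -> continuous (fun z => f z + g z).
Proof. by move=> cf cg z; apply: cvgD; [exact: cf|exact: cg]. Qed.

Lemma continuous_compose {T U V : topologicalType} (f : T -> U) (g : U -> V) :
  continuous f -> continuous g -> continuous (fun z => g (f z)).
Proof. by move=> cf cg z; apply: continuous_comp; [exact: cf|exact: cg]. Qed.

(** * Partial derivatives and test functions *)

Lemma derive_bound_lip {R : realType} (C : R) (F : R -> R) :
  (forall x, derivable F x 1) -> (forall x, `|'D_1 F x| <= C) -> lip_with C F.
Proof.
move=> dF FC.
suff key x y : x <= y -> `|F y - F x| <= C * `|y - x|.
  move=> x y; have [xy|/ltW yx] := leP x y; last exact: key.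
  by rewrite distrC (distrC x); exact: key.
move=> xy.
have [||c _ ->] := @MVT_segment R F (fun x => 'D_1 F x) x y xy.
- by move=> z _; apply: derivableP.
- apply: continuous_subspaceT => z.
  by apply: differentiable_continuous; apply/derivable1_diffP.
by rewrite normrM ler_wpM2r.
Qed.

Lemma is_derive_slice1 {R : realType} (psi : R * R -> R) x v :
  derivable psi (x, v) (1, 0) ->
  is_derive x 1 (fun y => psi (y, v)) ('D_(1, 0) psi (x, v)).
Proof.
move=> dp; have E : (fun h : R => h^-1 *:
  (((fun y => psi (y, v)) \o shift x) (h *: 1) - psi (x, v))) =
    (fun h : R => h^-1 *: ((psi \o shift (x, v)) (h *: (1, 0)) - psi (x, v))).
  apply/funext => h /=; congr (_ *: (psi _ - _)).
  by rewrite /shift/=; congr pair; rewrite /= scaler0 add0r.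
apply: DeriveDef; first by rewrite /derivable E.
by rewrite /derive E.
Qed.

Lemma is_derive_slice2 {R : realType} (psi : R * R -> R) x v :
  derivable psi (x, v) (0, 1) ->
  is_derive v 1 (fun w => psi (x, w)) ('D_(0, 1) psi (x, v)).
Proof.
move=> dp; have E : (fun h : R => h^-1 *:
  (((fun y => psi (x, y)) \o shift v) (h *: 1) - psi (x, v))) =
    (fun h : R => h^-1 *: ((psi \o shift (x, v)) (h *: (0, 1)) - psi (x, v))).
  apply/funext => h /=; congr (_ *: (psi _ - _)).
  by rewrite /shift/=; congr pair; rewrite /= scaler0 add0r.
apply: DeriveDef; first by rewrite /derivable E.
by rewrite /derive E.
Qed.

Lemma continuous_bounded_on_compact {T : topologicalType} {R : realType} (h : T -> R)
  (A : set T) :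
  continuous h -> compact A -> exists2 C : R, 0 < C & forall z, A z -> `|h z| <= C.
Proof.
move=> ch cA.
have : compact (h @` A) by apply: continuous_compact => //; exact: continuous_subspaceT.
move=> /compact_bounded [M [_ hM]].
exists (`|M| + 1); first by rewrite ltr_wpDl.
have lM : M < `|M| + 1 by rewrite ltr_pwDr// ler_norm.
by move=> z Az; apply: (hM _ lM); exists z.
Qed.

Lemma supported_bounded_integrable {R : realType} (h : R * R -> R) (C M : R) :
  measurable_fun setT h -> (forall z, `|h z| <= C) ->
  (forall z, M < `|z.1| \/ M < `|z.2| -> h z = 0) ->
  leb2.-integrable setT (EFin \o h).
Proof.
move=> mh hC h0.
pose Q : set (R * R) := `[- M, M]%classic `*` `[- M, M]%classic.
have mQ : measurable Q by apply: measurableX; exact: measurable_itv.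
have : leb2.-integrable Q (EFin \o h).
  apply: (@bounded_integrable _ _ _ _ _ _ C) => //; last exact: measurable_funTS.
  exact: lebesgue_rectangle.
rewrite integrable_mkcond//; apply: eq_integrable => // -[x y] _.
rewrite patchE; case: ifPn => // /negP xI /=; rewrite h0//=.
apply: contrapT => /not_orP[/negP h1 /negP h2]; apply: xI; rewrite inE.
by split; rewrite /= in_itv/= -ler_norml leNgt.
Qed.

Lemma test_function_bounds {R : realType} (psi : R * R -> R) : test_function psi ->
  exists P M : R,
   [/\ continuous psi /\ (forall z, `|psi z| <= P),
       forall z, M < `|z.1| \/ M < `|z.2| -> psi z = 0 &
       forall w : R * R, w = (1, 0) \/ w = (0, 1) ->
         [/\ continuous ('D_w psi), (forall z, derivable psi z w),
           (forall z, `|'D_w psi z| <= P) &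
           forall z, M < `|z.1| \/ M < `|z.2| -> 'D_w psi z = 0]].
Proof.
move=> [sp cp].
have [cpsi dpsi] := sp [::].
have cD w : continuous ('D_w psi) by have [] := sp [:: w].
have [M M0 hM] := compact_plane_bounded cp.
have out z : M < `|z.1| \/ M < `|z.2| -> ~ closure [set z | psi z != 0] z.
  by move=> h /hM [h1 h2]; case: h; rewrite ltNge ?h1 ?h2.
have p0 z : ~ closure [set z | psi z != 0] z -> psi z = 0.
  move=> h; apply: contrapT => /eqP pz; apply: h; exact: subset_closure.
have D0 w z : ~ closure [set z | psi z != 0] z -> 'D_w psi z = 0.
  move=> h; rewrite -(@derive_cst R (R * R)%type R 0 z w).
  apply: near_eq_derive.
  have : open (~` closure [set z | psi z != 0]) by apply: closed_openC;
    exact: closed_closure.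
  rewrite openE => /(_ _ h); apply: filterS => y yh.
  by rewrite p0.
have bnd (h : R * R -> R) : continuous h ->
   (forall z, ~ closure [set z | psi z != 0] z -> h z = 0) ->
   exists2 C : R, 0 < C & forall z, `|h z| <= C.
  move=> ch h0; have [C C0 hC] := continuous_bounded_on_compact ch cp.
  exists C => // z; have [/hC//|/h0 ->] := pselect (closure [set z | psi z != 0] z).
  by rewrite normr0 ltW.
have [C0 C00 hC0] := bnd _ cpsi p0.
have [C1 C10 hC1] := bnd _ (cD (1, 0)) (D0 (1, 0)).
have [C2 C20 hC2] := bnd _ (cD (0, 1)) (D0 (0, 1)).
exists (C0 + C1 + C2), M; split.
- split => // z; rewrite (le_trans (hC0 z))// -addrA lerDl addr_ge0// ltW//.
- by move=> z /out/p0.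
move=> w hw; split => // [z|z /out/D0//].
case: hw => ->.
  by rewrite (le_trans (hC1 z))// addrAC lerDr addr_ge0// ltW.
by rewrite (le_trans (hC2 z))// lerDr addr_ge0// ltW.
Qed.

(** * Weak gradients of Lipschitz functions *)

Lemma measurable_partial_slope1 {R : realType} (L : R) (u : R * R -> R) :
  continuous u -> (forall v, lip_with L (fun x => u (x, v))) ->
  measurable_fun setT (fun z => upper_slope (fun x => u (x, z.2)) z.1).
Proof.
move=> cu lu.
apply: (@measurable_upper_slope _ (R * R)%type R L (fun z x => u (x, z.2))
  (fun z => z.1)) => // c.
apply: continuous_measurable_plane.
apply: (@continuous_compose _ _ _ (fun z => (z.1 + c, z.2) : R * R) u) => //.
apply: continuous_pair; last exact: continuous_snd.
by apply: continuous_add; [exact: continuous_fst|exact: cst_continuous].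
Qed.

(** Integration by parts on each horizontal line, followed by Fubini's theorem. *)
Lemma weak_derivative_lip1 {R : realType} (L B : R) (u : R * R -> R) :
  continuous u -> (forall z, `|u z| <= B) ->
    (forall v, lip_with L (fun x => u (x, v))) ->
  weak_derivative (1, 0) u (fun z => upper_slope (fun x => u (x, z.2)) z.1).
Proof.
move=> cu uB lu.
have mg := measurable_partial_slope1 cu lu.
have gL z : `|upper_slope (fun x => u (x, z.2)) z.1| <= L by exact: upper_slope_bound.
split.
  move=> A cA; apply: (@bounded_integrable _ _ _ _ _ _ L) => //.
  - exact: compact_measurable_plane.
  - exact: compact_finite_plane.
  - exact: measurable_funTS.
move=> psi /test_function_bounds [P [M [[cpsi psiP] psi0 /(_ (1, 0)) []]]];
  first by left.
move=> cD dpsi DP D0.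
have mu : measurable_fun setT u by exact: continuous_measurable_plane.
have mp : measurable_fun setT psi by exact: continuous_measurable_plane.
have mD : measurable_fun setT ('D_(1, 0) psi) by exact: continuous_measurable_plane.
have i1 : leb2.-integrable setT (EFin \o (fun z => u z * 'D_(1, 0) psi z)).
  apply: (@supported_bounded_integrable _ _ (B * P) M) => [|z|z /D0 ->].
  - exact: measurable_funM.
  - by rewrite normrM ler_pM.
  - by rewrite mulr0.
have i2 : leb2.-integrable setT
  (EFin \o (fun z => upper_slope (fun x => u (x, z.2)) z.1 * psi z)).
  apply: (@supported_bounded_integrable _ _ (L * P) M) => [|z|z /psi0 ->].
  - exact: measurable_funM.
  - by rewrite normrM ler_pM.
  - by rewrite mulr0.
have i2N : leb2.-integrable setT
  (EFin \o (fun z => - (upper_slope (fun x => u (x, z.2)) z.1 * psi z))).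
  apply: (@supported_bounded_integrable _ _ (L * P) M) => [|z|z /psi0 ->].
  - by apply: measurableT_comp => //; exact: measurable_funM.
  - by rewrite normrN normrM ler_pM.
  - by rewrite mulr0 oppr0.
have line (v : R) :
    (\int[leb]_x (u (x, v) * 'D_(1, 0) psi (x, v))%:E =
     \int[leb]_x (- (upper_slope (fun x => u (x, v)) x * psi (x, v)))%:E)%E.
  have dsl (x : R) : is_derive x (1 : R) (fun x : R => psi (x, v))
    ('D_(1, 0) psi (x, v)).
    exact: is_derive_slice1.
  have dslE (x : R) : 'D_1 (fun x : R => psi (x, v)) x = 'D_(1, 0) psi (x, v).
    by have [] := dsl x.
  under eq_integral do rewrite -dslE.
  apply: (@lip_integration_by_parts R L P B P M (fun x => u (x, v))
    (fun x => psi (x, v))) => //.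
  - apply: derive_bound_lip => x; last by rewrite dslE.
    by have [] := dsl x.
  - by move=> x h; apply: psi0; left.
transitivity (\int[leb2]_(z in setT)
  (- (upper_slope (fun x => u (x, z.2)) z.1 * psi z)))%R; last first.
  under eq_Rintegral do rewrite -mulN1r.
  by rewrite RintegralZl// mulN1r.
rewrite /Rintegral; congr fine.
rewrite -[LHS](@integral21_prod_meas1 _ _ _ _ R leb leb _ i1).
rewrite -[RHS](@integral21_prod_meas1 _ _ _ _ R leb leb _ i2N).
by apply: eq_integral => v _; exact: line.
Qed.

Lemma measurable_partial_slope2 {R : realType} (L : R) (u : R * R -> R) :
  continuous u -> (forall x, lip_with L (fun v => u (x, v))) ->
  measurable_fun setT (fun z => upper_slope (fun v => u (z.1, v)) z.2).
Proof.
move=> cu lu.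
apply: (@measurable_upper_slope _ (R * R)%type R L (fun z v => u (z.1, v))
  (fun z => z.2)) => // c.
apply: continuous_measurable_plane.
apply: (@continuous_compose _ _ _ (fun z => (z.1, z.2 + c) : R * R) u) => //.
apply: continuous_pair; first exact: continuous_fst.
by apply: continuous_add; [exact: continuous_snd|exact: cst_continuous].
Qed.

(** The same on vertical lines. *)
Lemma weak_derivative_lip2 {R : realType} (L B : R) (u : R * R -> R) :
  continuous u -> (forall z, `|u z| <= B) ->
    (forall x, lip_with L (fun v => u (x, v))) ->
  weak_derivative (0, 1) u (fun z => upper_slope (fun v => u (z.1, v)) z.2).
Proof.
move=> cu uB lu.
have mg := measurable_partial_slope2 cu lu.
have gL z : `|upper_slope (fun v => u (z.1, v)) z.2| <= L by exact: upper_slope_bound.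
split.
  move=> A cA; apply: (@bounded_integrable _ _ _ _ _ _ L) => //.
  - exact: compact_measurable_plane.
  - exact: compact_finite_plane.
  - exact: measurable_funTS.
move=> psi /test_function_bounds [P [M [[cpsi psiP] psi0 /(_ (0, 1)) []]]];
  first by right.
move=> cD dpsi DP D0.
have mu : measurable_fun setT u by exact: continuous_measurable_plane.
have mp : measurable_fun setT psi by exact: continuous_measurable_plane.
have mD : measurable_fun setT ('D_(0, 1) psi) by exact: continuous_measurable_plane.
have i1 : leb2.-integrable setT (EFin \o (fun z => u z * 'D_(0, 1) psi z)).
  apply: (@supported_bounded_integrable _ _ (B * P) M) => [|z|z /D0 ->].
  - exact: measurable_funM.
  - by rewrite normrM ler_pM.
  - by rewrite mulr0.
have i2 : leb2.-integrable setT
  (EFin \o (fun z => upper_slope (fun v => u (z.1, v)) z.2 * psi z)).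
  apply: (@supported_bounded_integrable _ _ (L * P) M) => [|z|z /psi0 ->].
  - exact: measurable_funM.
  - by rewrite normrM ler_pM.
  - by rewrite mulr0.
have i2N : leb2.-integrable setT
  (EFin \o (fun z => - (upper_slope (fun v => u (z.1, v)) z.2 * psi z))).
  apply: (@supported_bounded_integrable _ _ (L * P) M) => [|z|z /psi0 ->].
  - by apply: measurableT_comp => //; exact: measurable_funM.
  - by rewrite normrN normrM ler_pM.
  - by rewrite mulr0 oppr0.
have line (x : R) :
    (\int[leb]_v (u (x, v) * 'D_(0, 1) psi (x, v))%:E =
     \int[leb]_v (- (upper_slope (fun v => u (x, v)) v * psi (x, v)))%:E)%E.
  have dsl (v : R) : is_derive v (1 : R) (fun v : R => psi (x, v))
    ('D_(0, 1) psi (x, v)).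
    exact: is_derive_slice2.
  have dslE (v : R) : 'D_1 (fun v : R => psi (x, v)) v = 'D_(0, 1) psi (x, v).
    by have [] := dsl v.
  under eq_integral do rewrite -dslE.
  apply: (@lip_integration_by_parts R L P B P M (fun v => u (x, v))
    (fun v => psi (x, v))) => //.
  - apply: derive_bound_lip => v; last by rewrite dslE.
    by have [] := dsl v.
  - by move=> v h; apply: psi0; right.
transitivity (\int[leb2]_(z in setT)
  (- (upper_slope (fun v => u (z.1, v)) z.2 * psi z)))%R; last first.
  under eq_Rintegral do rewrite -mulN1r.
  by rewrite RintegralZl// mulN1r.
rewrite /Rintegral; congr fine.
rewrite -[LHS](@integral12_prod_meas1 _ _ _ _ R leb leb _ i1).
rewrite -[RHS](@integral12_prod_meas1 _ _ _ _ R leb leb _ i2N).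
by apply: eq_integral => x _; exact: line.
Qed.

(** The Euclidean norm of a pair of slopes bounded by L is at most sqrt 2 L. *)
Lemma lip_weak_gradient {R : realType} (L B : R) (u : R * R -> R) :
  continuous u -> (forall z, `|u z| <= B) ->
  (forall v, lip_with L (fun x => u (x, v))) ->
  (forall x, lip_with L (fun v => u (x, v))) ->
  exists g : R * R -> R * R,
    weak_gradient u g /\ (Linfty_norm g <= (2 * L)%:E)%E.
Proof.
move=> cu uB lu1 lu2.
exists (fun z => (upper_slope (fun x => u (x, z.2)) z.1,
                  upper_slope (fun v => u (z.1, v)) z.2)); split.
  split.
  - apply/measurable_fun_pairP; split.
      exact: (measurable_partial_slope1 cu lu1).
    exact: (measurable_partial_slope2 cu lu2).
  - exact: (weak_derivative_lip1 cu uB lu1).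
  - exact: (weak_derivative_lip2 cu uB lu2).
have L0 := lip_with_ge0 (lu1 0).
rewrite /Linfty_norm unlock; case: ifPn => _; last by rewrite lee_fin mulr_ge0.
apply/ess_supP; apply: aeW => z /=; rewrite lee_fin /eucl ger0_norm ?sqrtr_ge0//=.
set a := upper_slope _ _; set b := upper_slope _ _.
have aL : `|a| <= L by exact: upper_slope_bound.
have bL : `|b| <= L by exact: upper_slope_bound.
have -> : 2 * L = Num.sqrt ((2 * L) ^+ 2) by rewrite sqrtr_sqr ger0_norm ?mulr_ge0.
rewrite ler_wsqrtr//.
have := sqr_ge0 L.
have : a ^+ 2 <= L ^+ 2 by rewrite -real_normK ?num_real// ler_sqr ?nnegrE.
have : b ^+ 2 <= L ^+ 2 by rewrite -real_normK ?num_real// ler_sqr ?nnegrE.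
nra.
Qed.

(** * Integrals of translated and of periodic functions *)

Lemma pushforward_translation {R : realType} (c : R) (A : set R) : measurable A ->
  leb A = pushforward leb (fun x : R => x + c) A.
Proof.
move=> mA.
have ms : measurable_fun (setT : set (measurableTypeR R))
  (fun x : measurableTypeR R => x + c : measurableTypeR R).
  exact: measurable_funD.
pose mu : {measure set (measurableTypeR R) -> \bar R} :=
  pushforward leb (fun x : measurableTypeR R => x + c : measurableTypeR R).
apply: (@lebesgue_measure_unique R (mu ms) _ A mA) => _ [[a b] _ <-].
change (leb `]a, b]%classic = leb ((fun x : R => x + c) @^-1` `]a, b]%classic)).
have -> : (fun x : R => x + c) @^-1` `]a, b]%classic = `]a - c, b - c]%classic.
  by apply/seteqP; split => x /=; rewrite !in_itv/= ltrBlDr lerBrDr.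
rewrite !lebesgue_measure_itv/= !lte_fin ltrD2r; case: ifP => // _.
by rewrite -!EFinB; congr EFin; ring.
Qed.

Lemma ge0_integral_translation {R : realType} (c : R) (D : set R) (f : R -> \bar R) :
  measurable D -> measurable_fun D f -> {in D, forall x, (0 <= f x)%E} ->
  (\int[leb]_(x in (fun x : R => (x + c)%R) @^-1` D) f (x + c)%R = \int[leb]_(x in D)
    f x)%E.
Proof.
move=> mD mf f0.
have ms : measurable_fun (setT : set (measurableTypeR R))
  (fun x : measurableTypeR R => x + c : measurableTypeR R).
  exact: measurable_funD.
rewrite -[LHS](ge0_integral_pushforward ms leb mD mf f0).
by apply: eq_measure_integral => A mA _; rewrite [RHS](pushforward_translation c mA).
Qed.

Lemma ge0_integral_translationT {R : realType} (c : R) (f : R -> \bar R) :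
  measurable_fun setT f -> (forall x, (0 <= f x)%E) ->
  (\int[leb]_x f (x + c)%R = \int[leb]_x f x)%E.
Proof.
move=> mf f0; rewrite -[RHS](@ge0_integral_translation _ c setT f)//.
Qed.

Lemma periodic_int {R : realType} (f : R -> R) (n : int) x :
  periodic f 1 -> f (x + n%:~R) = f x.
Proof.
move=> pf; case: n => n; first by rewrite -pmulrn; exact: periodicn.
rewrite NegzE mulrNz -pmulrn.
by rewrite -[in RHS](subrK (n.+1%:R : R) x) (periodicn pf).
Qed.

Lemma fracpart_itv {R : realType} (x : R) : 0 <= fracpart x < 1.
Proof.
rewrite /fracpart subr_ge0 floor_le ltrBlDl.
by have := floorD1_gt x; rewrite intrD addrC.
Qed.

Lemma periodic_fracpart {R : realType} (f : R -> R) x :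
  periodic f 1 -> f (fracpart x) = f x.
Proof.
by move=> pf; rewrite -[in LHS](periodic_int (Num.floor x) _ pf) subrK.
Qed.

(** Only the fractional part r of c matters.  The translation carries [0, 1 - r[
    onto [r, 1[ and [1 - r, 1] onto [1, 1 + r], which periodicity moves back to
    [0, r]. *)
Lemma ge0_integral_periodic {R : realType} (c : R) (f : R -> R) :
  continuous f -> (forall x, 0 <= f x) -> periodic f 1 ->
  (\int[leb]_(x in `[0%R, 1%R]) (f (x + c))%:E = \int[leb]_(x in `[0%R, 1%R])
    (f x)%:E)%E.
Proof.
move=> cf f0 pf.
pose r := fracpart c; have /andP[r0 r1] : 0 <= r < 1 by exact: fracpart_itv.
have -> : (\int[leb]_(x in `[0%R, 1%R]) (f (x + c))%:E =
           \int[leb]_(x in `[0%R, 1%R]) (f (x + r))%:E)%E.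
  apply: eq_integral => x _; congr EFin.
  by rewrite -[in RHS](@periodic_int _ f (Num.floor c))// /r /fracpart -addrA subrK.
have mf : measurable_fun setT f by exact: continuous_measurable_fun.
have mfE (D : set R) : measurable_fun D (EFin \o f).
  by apply/measurable_EFinP; exact: measurable_funTS.
have mfr (D : set R) : measurable_fun D (fun x => (f (x + r))%:E).
  apply/measurable_EFinP; apply: measurable_funTS; apply: continuous_measurable_fun.
  apply: (continuous_compose _ cf).
  by apply: continuous_add; [move=> z; exact: cvg_id|exact: cst_continuous].
pose A : set R := `[0, 1 - r[%classic; pose B : set R := `[1 - r, 1]%classic.
pose A' : set R := `[r, 1[%classic; pose B' : set R := `[0, r]%classic.
have split1 : (`[0, 1]%classic : set R) = A `|` B.
  rewrite /A /B; apply/seteqP; split => x /=; rewrite !in_itv/=.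
    by case: (ltP x (1 - r)) => h /andP[-> ->]; [left|right].
  by case=> /andP[h1 h2]; apply/andP; split => //; lra.
have tr1 : (\int[leb]_(x in A) (f (x + r))%:E = \int[leb]_(x in A') (f x)%:E)%E.
  rewrite -(@ge0_integral_translation _ r A')//; last 2 first.
    exact: measurable_itv.
    by move=> x _; rewrite lee_fin.
  have -> // : (fun x : R => (x + r)%R) @^-1` A' = A.
  by rewrite /A /A'; apply/seteqP; split => x /=; rewrite !in_itv/= => /andP[h1 h2];
    apply/andP; split; lra.
have tr2 : (\int[leb]_(x in B) (f (x + r))%:E = \int[leb]_(x in B') (f x)%:E)%E.
  rewrite -(@ge0_integral_translation _ (r - 1) B')//; last 2 first.
    exact: measurable_itv.
    by move=> x _; rewrite lee_fin.
  have -> : (fun x : R => (x + (r - 1))%R) @^-1` B' = B.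
    by rewrite /B /B'; apply/seteqP; split => x /=; rewrite !in_itv/= => /andP[h1 h2];
      apply/andP; split; lra.
  apply: eq_integral => x _; congr EFin.
  by rewrite -[in RHS]pf; congr f; ring.
rewrite {1}split1 (ge0_integral_setU leb (measurable_itv _) (measurable_itv _));
  last 3 first.
- exact: mfr.
- by move=> x _; rewrite lee_fin.
- rewrite disj_set2E /A /B; apply/eqP/seteqP; split => x //= [];
  rewrite !in_itv/= => /andP[_ h1] /andP[h2 _]; lra.
rewrite tr1 tr2 addeC.
rewrite /B' integral_itv_bndoo; last exact: mfE.
rewrite /A' -(@integral_itv_bndoo _ 0 r _ true true); last exact: mfE.
rewrite -(ge0_integral_setU leb (measurable_itv _) (measurable_itv _)); last 3 first.
- exact: mfE.
- by move=> x _; rewrite lee_fin.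
- rewrite disj_set2E; apply/eqP/seteqP; split => x //= [];
  rewrite !in_itv/= => /andP[_ h1] /andP[h2 _]; lra.
have -> : (`[0%R, r[ `|` `[r, 1%R[)%classic = (`[0, 1[%classic : set R).
  apply/seteqP; split => x /=; rewrite !in_itv/=.
    by case=> /andP[h1 h2]; apply/andP; split => //; lra.
  by case: (ltP x r) => h /andP[-> ->]; [left|right].
by rewrite -[RHS]integral_itv_bndo_bndc.
Qed.

(** * Shears preserve integrals over the cylinder *)

Lemma measurable_cylinder {R : realType} : measurable (@cylinder R).
Proof. by apply: measurableX; [exact: measurable_itv|exact: measurableT]. Qed.

Lemma in_cylinder {R : realType} (x v : R) : ((x, v) \in @cylinder R)
  = (x \in (`[0, 1]%classic : set R)).
Proof. by apply/idP/idP; rewrite !inE /cylinder/=; [case|move=> ?; split]. Qed.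

Lemma integral_cylinder12 {R : realType} (h : R * R -> \bar R) :
  measurable_fun cylinder h -> (forall z, 0 <= h z)%E ->
  (\int[leb2]_(z in cylinder) h z = \int[leb]_(x in `[0%R, 1%R])
    \int[leb]_v h (x, v))%E.
Proof.
move=> mh h0; rewrite integral_mkcond fubini_tonelli1.
- rewrite [RHS]integral_mkcond; apply: eq_integral => x _.
  rewrite /fubini_F patchE; case: ifPn => xI.
    by apply: eq_integral => v _; rewrite patchE in_cylinder xI.
  by rewrite integral0_eq// => v _; rewrite patchE in_cylinder (negbTE xI).
- by apply/(measurable_restrictT _ _).1 => //; exact: measurable_cylinder.
- by move=> z; rewrite patchE; case: ifP.
Qed.

Lemma integral_cylinder21 {R : realType} (h : R * R -> \bar R) :
  measurable_fun cylinder h -> (forall z, 0 <= h z)%E ->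
  (\int[leb2]_(z in cylinder) h z = \int[leb]_v \int[leb]_(x in `[0%R, 1%R])
    h (x, v))%E.
Proof.
move=> mh h0; rewrite integral_mkcond fubini_tonelli2.
- apply: eq_integral => v _.
  rewrite /fubini_G [RHS]integral_mkcond; apply: eq_integral => x _.
  by rewrite !patchE in_cylinder.
- by apply/(measurable_restrictT _ _).1 => //; exact: measurable_cylinder.
- by move=> z; rewrite patchE; case: ifP.
Qed.

Lemma continuous_slice1 {R : realType} (h : R * R -> R) v : continuous h ->
  continuous (fun x => h (x, v)).
Proof.
move=> ch; apply: (@continuous_compose _ _ _ (fun x : R => (x, v)) h) => //.
by apply: continuous_pair; [move=> ?; exact: cvg_id|exact: cst_continuous].
Qed.

Lemma continuous_slice2 {R : realType} (h : R * R -> R) x : continuous h ->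
  continuous (fun v => h (x, v)).
Proof.
move=> ch; apply: (@continuous_compose _ _ _ (fun v : R => (x, v)) h) => //.
by apply: continuous_pair; [exact: cst_continuous|move=> ?; exact: cvg_id].
Qed.

(** With drift, one of the two shears that make up a step of the symplectic Euler
    scheme.  Shears preserve the Lebesgue measure even if e is not differentiable. *)
Definition kick {R : realType} (e : R -> R) (z : R * R) : R * R := (z.1, z.2 + e z.1).

Definition drift {R : realType} (h : R) (z : R * R) : R * R := (z.1 + h * z.2, z.2).

Lemma continuous_kick {R : realType} (e : R -> R) : continuous e -> continuous (kick e).
Proof.
move=> ce; apply: continuous_pair; first exact: continuous_fst.
apply: continuous_add; first exact: continuous_snd.
exact: (continuous_compose continuous_fst).
Qed.

Lemma continuous_drift {R : realType} (h : R) : continuous (drift h).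
Proof.
apply: continuous_pair; last exact: continuous_snd.
apply: continuous_add; first exact: continuous_fst.
by apply: (continuous_compose continuous_snd); exact: mulrl_continuous.
Qed.

Lemma integral_kick {R : realType} (e : R -> R) (G : R * R -> R) :
  continuous e -> continuous G -> (forall z, 0 <= G z) ->
  (\int[leb2]_(z in cylinder) (G (kick e z))%:E = \int[leb2]_(z in cylinder)
    (G z)%:E)%E.
Proof.
move=> ce cG G0.
have mE (k : R * R -> R) : continuous k -> measurable_fun cylinder (EFin \o k).
  move=> ck; apply/measurable_EFinP; apply: measurable_funTS.
  exact: continuous_measurable_plane.
have cGk : continuous (G \o kick e) by exact: (continuous_compose (continuous_kick ce)).
rewrite (integral_cylinder12 (mE _ cGk)); last by move=> z; rewrite /= lee_fin.
rewrite (integral_cylinder12 (mE _ cG)); last by move=> z; rewrite /= lee_fin.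
apply: eq_integral => x _.
apply: (@ge0_integral_translationT _ (e x) (fun v => (G (x, v))%:E)).
  by apply/measurable_EFinP; apply: continuous_measurable_fun; exact: continuous_slice2.
by move=> v; rewrite lee_fin.
Qed.

Lemma integral_drift {R : realType} (h : R) (G : R * R -> R) :
  periodic_x G -> continuous G -> (forall z, 0 <= G z) ->
  (\int[leb2]_(z in cylinder) (G (drift h z))%:E = \int[leb2]_(z in cylinder)
    (G z)%:E)%E.
Proof.
move=> pG cG G0.
have mE (k : R * R -> R) : continuous k -> measurable_fun cylinder (EFin \o k).
  move=> ck; apply/measurable_EFinP; apply: measurable_funTS.
  exact: continuous_measurable_plane.
have cGk : continuous (G \o drift h)
  by exact: (continuous_compose (@continuous_drift R h)).
rewrite (integral_cylinder21 (mE _ cGk)); last by move=> z; rewrite /= lee_fin.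
rewrite (integral_cylinder21 (mE _ cG)); last by move=> z; rewrite /= lee_fin.
apply: eq_integral => v _.
apply: (@ge0_integral_periodic _ (h * v) (fun x => G (x, v))) => //.
  exact: continuous_slice1.
by move=> x; rewrite -[RHS]pG; congr G; congr pair; rewrite /= addr0.
Qed.

(** * Characteristic curves and their dependence on the endpoint *)

Lemma segment_unif_continuous {R : realType} (f : R -> R) (a b e : R) :
  {within `[a, b], continuous f} -> 0 < e ->
  exists2 d : R, 0 < d &
    forall x y, a <= x <= b -> a <= y <= b -> `|x - y| <= d -> `|f x - f y| <= e.
Proof.
move=> cf e0.
have e20 : 0 < e / 2 by rewrite divr_gt0.
have /compact_near_coveringP/near_covering_withinP nc := @segment_compact R a b.
(* compactness is used in its near-covering form, with d --> 0^'+ *)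
pose P (d x : R) := forall y, a <= y <= b -> `|x - y| <= d -> `|f x - f y| <= e.
have : \forall d \near 0^'+, `[a, b]%classic `<=` P d.
  apply: nc => x xab.
  have /cvgrPdist_le/(_ _ e20) := (subspace_continuousP _ f).1 cf x xab.
  rewrite near_withinE => -[r /= r0 hr].
  exists (ball x (r / 2), [set d | d < r / 2]) => /=.
    split; first by apply: nbhsx_ballx; rewrite divr_gt0.
    by apply: nbhs_right_lt; rewrite divr_gt0.
  move=> [x' d]/= [xx' dr] x'ab y yab x'y.
  have h1 : `|f x - f x'| <= e / 2.
    apply: hr => //; apply: lt_trans xx' _.
    by rewrite ltr_pdivrMr// ltr_pMr// ltr1n.
  have h2 : `|f x - f y| <= e / 2.
    apply: hr; last by rewrite /= in_itv.
    rewrite /= -(subrKA x') (le_lt_trans (ler_normD _ _))// (splitr r) ltr_leD//.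
    by rewrite (le_trans x'y)// ltW.
  rewrite -(subrKA (f x)) (le_trans (ler_normD _ _))// (splitr e) lerD//.
  by rewrite distrC.
move=> h; have : \forall d \near (0:R)^'+, 0 < d /\ `[a, b]%classic `<=` P d.
  by near=> d; split => //; near: d.
move=> /filter_ex [d [d0 hd]]; exists d => // x y xab yab xy.
by apply: hd => //; rewrite /= in_itv.
Unshelve. all: by end_near. Qed.

Definition trajectory {R : realType} (E : R -> R -> R) (t : R) (X V : R -> R) : Prop :=
  [/\ {within `[0, t], continuous X}, {within `[0, t], continuous V} &
      forall s, 0 < s < t -> is_derive s 1 X (V s) /\ is_derive s 1 V (- E s (X s))].

(** If q is the squared distance of two trajectories, then
    |q'| <= 2 (1 + L) |dx| |dv| <= (1 + L) q, so q(s) exp ((1 + L) s) is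
    nondecreasing in s. *)
Lemma trajectory_gronwall {R : realType} (E : R -> R -> R) (L t : R)
  (X V Y W : R -> R) :
  0 < t -> 0 <= L -> (forall s, 0 <= s <= t -> lip_with L (E s)) ->
  trajectory E t X V -> trajectory E t Y W ->
  (X 0 - Y 0) ^+ 2 + (V 0 - W 0) ^+ 2 <=
  ((X t - Y t) ^+ 2 + (V t - W t) ^+ 2) * expR ((1 + L) * t).
Proof.
move=> t0 L0 lE [cX cV dXV] [cY cW dYW].
pose q s := (X s - Y s) ^+ 2 + (V s - W s) ^+ 2.
pose F s := q s * expR ((1 + L) * s).
pose dF s := (2 * (X s - Y s) * (V s - W s) - 2 * (V s - W s) * (E s (X s) - E s (Y s))
  + (1 + L) * q s)
   * expR ((1 + L) * s).
have dFE s : s \in `]0, t[%R -> is_derive s 1 F (dF s).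
  rewrite in_itv/= => st; have [dX dV] := dXV _ st; have [dY dW] := dYW _ st.
  have d1 := is_deriveX 2 (is_deriveB dX dY).
  have d2 := is_deriveX 2 (is_deriveB dV dW).
  have d3 : is_derive s 1 (fun s => expR ((1 + L) * s)) ((1 + L) * expR ((1 + L) * s)).
    have d4 : is_derive s 1 (fun s : R => (1 + L) * s) (1 + L).
      have := @is_deriveZ R R R id (1 + L) s 1 1 (is_derive_id _ _).
      by rewrite scaler1.
    by rewrite mulrC; exact: (is_derive1_comp (is_derive_expR _) d4).
  have d5 : is_derive s 1 F _ := is_deriveM (is_deriveD d1 d2) d3.
  apply: (is_derive_eq d5); rewrite /dF /q /GRing.scale/= !expr1.
  change ((X - Y) s) with (X s - Y s); change ((V - W) s) with (V s - W s).
  change (((X - Y) ^+ 2 + (V - W) ^+ 2) s) with ((X s - Y s) ^+ 2 + (V s - W s) ^+ 2).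
  move: (X s - Y s) (V s - W s) (E s (X s)) (E s (Y s)) (expR ((1 + L) * s))
    => a b c d e.
  by ring.
have cF : {within `[0, t], continuous F}.
  have cE : {within `[0, t], continuous (fun s => expR ((1 + L) * s))}.
    apply: continuous_subspaceT; apply: (@continuous_compose _ _ _
      (fun s : R => (1 + L) * s) expR).
      exact: mulrl_continuous.
    exact: continuous_expR.
  move=> s; apply: cvgM; last exact: cE.
  by apply: cvgD; apply: cvgM; apply: cvgB;
    first [exact: cX|exact: cY|exact: cV|exact: cW].
have [c ct] := MVT t0 dFE cF.
move=> Ec.
have : F 0 <= F t.
  rewrite -subr_ge0 Ec mulr_ge0// ?subr0 ?(ltW t0)// /dF mulr_ge0 ?expR_ge0//.
  have st : 0 <= c <= t by rewrite ltW ?(itvP ct)// ltW ?(itvP ct).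
  have := lE c st (X c) (Y c); rewrite /q.
  move: (X c - Y c) (V c - W c) (E c (X c) - E c (Y c)) => a b d h.
  have ab : `|a * b| <= (a ^+ 2 + b ^+ 2) / 2.
    rewrite normrM -(real_normK (num_real a)) -(real_normK (num_real b)).
    have := sqr_ge0 (`|a| - `|b|); nra.
  have bd : `|b * d| <= L * ((a ^+ 2 + b ^+ 2) / 2).
    rewrite normrM (le_trans (ler_wpM2l _ h))//.
    have := ler_wpM2l L0 ab; rewrite normrM; nra.
  move: ab bd; rewrite !ler_norml => /andP[ab _] /andP[_ bd].
  nra.
by rewrite /F mulr0 expR0 mulr1.
Qed.

(** * The backward Euler scheme *)

Lemma trajectory_increment {R : realType} (E : R -> R -> R) (t : R) (X V : R -> R)
  (a b : R) :
  trajectory E t X V -> 0 <= a -> a < b -> b <= t ->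
  (exists2 c, a <= c <= b & X b - X a = V c * (b - a)) /\
  (exists2 c, a <= c <= b & V b - V a = - E c (X c) * (b - a)).
Proof.
move=> [cX cV dXV] a0 ab bt.
have sub : `[a, b]%classic `<=` `[0, t]%classic.
  by move=> x /=; rewrite !in_itv/= => /andP[h1 h2]; apply/andP; split; lra.
have dab s : s \in `]a, b[%R -> is_derive s 1 X (V s) /\ is_derive s 1 V (- E s (X s)).
  by rewrite in_itv/= => /andP[h1 h2]; apply: dXV; apply/andP; split; lra.
split.
  have [c cab ->] := MVT ab (fun s h => (dab s h).1) (continuous_subspaceW sub cX).
  by exists c => //; rewrite !ltW ?(itvP cab).
have [c cab ->] := @MVT R V (fun s => - E s (X s)) a b ab (fun s h => (dab s h).2)
  (continuous_subspaceW sub cV).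
by exists c => //; rewrite !ltW ?(itvP cab).
Qed.

(** A step of length h backwards in time.  The velocity is updated first and the
    position then moves with the new velocity; this order makes the step a
    composition of two shears. *)
Definition euler_step {R : realType} (e : R -> R) (h : R) (z : R * R) : R * R :=
  drift (- h) (kick (fun x => h * e x) z).

Fixpoint backward_euler {R : realType} (E : R -> R -> R) (h : R) (n : nat)
  (z : R * R) : R * R :=
  if n is k.+1 then backward_euler E h k (euler_step (E (k.+1%:R * h)) h z) else z.

(** Here w bounds the oscillation of the force and of the velocity along the exact
    trajectory during the step.  By the mean value theorem the exact increments
    are h times values taken inside the step, so a step adds an error O(h w). *)
Lemma euler_step_error {R : realType} (E : R -> R -> R) (L t w s h : R) (X V : R -> R)
  (z : R * R) :
  0 <= L -> 0 < h <= 1 -> h <= s <= t -> lip_with L (E s) ->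
  trajectory E t X V ->
  (forall c, s - h <= c <= s -> `|E c (X c) - E s (X s)| <= w /\
    `|V c - V (s - h)| <= w) ->
  `|(euler_step (E s) h z).1 - X (s - h)| + `|(euler_step (E s) h z).2 - V (s - h)| <=
  (1 + h * (1 + 2 * L)) * (`|z.1 - X s| + `|z.2 - V s|) + 3 * h * w.
Proof.
move=> L0 /andP[h0 h1] /andP[hs st] lE tr osc.
have w0 : 0 <= w.
  have [] := osc s; last by move=> + _; rewrite subrr normr0.
  by rewrite lexx andbT gerBl ltW.
have sh0 : 0 <= s - h by rewrite subr_ge0.
have shs : s - h < s by rewrite ltrBlDr ltrDl.
have [[c1 c1s dX] [c2 c2s dV]] := trajectory_increment tr sh0 shs st.
have [_ osc1] := osc c1 c1s; have [osc2 _] := osc c2 c2s.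
rewrite /euler_step /drift /kick /=; case: z => x v /=.
set v' := v + h * E s x.
set a := `|x - X s|; set b := `|v - V s|.
have a0 : 0 <= a by exact: normr_ge0.
have b0 : 0 <= b by exact: normr_ge0.
have le_b : `|v' - V (s - h)| <= b + h * L * a + h * w.
  have -> : v' - V (s - h) = (v - V s) + h * (E s x - E s (X s))
    - h * (E c2 (X c2) - E s (X s)).
    rewrite /v' (_ : V (s - h) = V s - - E c2 (X c2) * (s - (s - h)));
      last by rewrite -dV; ring.
    ring.
  apply: le_trans (ler_normB _ _) _; apply: lerD.
    apply: le_trans (ler_normD _ _) _; rewrite lerD2l normrM gtr0_norm//.
    by rewrite -mulrA ler_wpM2l ?(ltW h0).
  by rewrite normrM gtr0_norm// ler_wpM2l ?(ltW h0).
have le_a : `|x + - h * v' - X (s - h)| <= a + h * (b + h * L * a + h * w) + h * w.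
  have -> : x + - h * v' - X (s - h) = (x - X s) - h * (v' - V (s - h))
    + h * (V c1 - V (s - h)).
    rewrite (_ : X (s - h) = X s - V c1 * (s - (s - h))); last by rewrite -dX; ring.
    ring.
  apply: le_trans (ler_normD _ _) _; apply: lerD.
    apply: le_trans (ler_normB _ _) _; rewrite lerD2l normrM gtr0_norm//.
    by rewrite ler_wpM2l ?(ltW h0).
  by rewrite normrM gtr0_norm// ler_wpM2l ?(ltW h0).
apply: le_trans (lerD le_a le_b) _.
have hLa : 0 <= h * L * a by rewrite !mulr_ge0 ?(ltW h0).
have hb : 0 <= h * L * b by rewrite !mulr_ge0 ?(ltW h0).
have hw : 0 <= h * w by rewrite mulr_ge0 ?(ltW h0).
have ha : 0 <= h * a by rewrite mulr_ge0 ?(ltW h0).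
have k1 : h * (h * L * a) <= h * L * a by rewrite ler_piMl.
have k2 : h * (h * w) <= h * w by rewrite ler_piMl.
nra.
Qed.

(** The discrete Gronwall inequality: each step multiplies the error by at most
    1 + h (1 + 2 L) and adds 3 h w. *)
Lemma backward_euler_error {R : realType} (E : R -> R -> R) (L t w h : R)
  (X V : R -> R) (n : nat) (z : R * R) :
  0 <= L -> 0 < h <= 1 -> n%:R * h <= t ->
    (forall s, 0 <= s <= t -> lip_with L (E s)) ->
  trajectory E t X V ->
  (forall c s, 0 <= c <= t -> 0 <= s <= t -> `|c - s| <= h ->
     `|E c (X c) - E s (X s)| <= w /\ `|V c - V s| <= w) ->
  `|(backward_euler E h n z).1 - X 0| + `|(backward_euler E h n z).2 - V 0| <=
  (1 + h * (1 + 2 * L)) ^+ n * ((`|z.1 - X (n%:R * h)| + `|z.2 - V (n%:R * h)|)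
    + 3 * (n%:R * h) * w).
Proof.
move=> L0 hh + lE tr osc; have /andP[h0 h1] := hh.
elim: n z => [z _|n IH z nt] /=.
  by rewrite expr0 mul1r !mul0r mulr0 mul0r addr0.
have nE : n.+1%:R * h - h = n%:R * h by rewrite -natr1; ring.
have nh0 : 0 <= n%:R * h by rewrite mulr_ge0// ltW.
have nh : n%:R * h <= t by rewrite -nE; lra.
have A1 : 1 <= 1 + h * (1 + 2 * L)
  by rewrite lerDl mulr_ge0 ?(ltW h0)// addr_ge0// mulr_ge0.
have w0 : 0 <= w.
  have z0t : 0 <= (0 : R) <= t by rewrite lexx (le_trans nh0).
  have [|+ _] := osc 0 0 z0t z0t; first by rewrite subrr normr0 ltW.
  by rewrite subrr normr0.
have hn : h <= n.+1%:R * h <= t by rewrite nt andbT; lra.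
have n1t : 0 <= n.+1%:R * h <= t by rewrite nt andbT; lra.
have osc1 c : n.+1%:R * h - h <= c <= n.+1%:R * h ->
    `|E c (X c) - E (n.+1%:R * h) (X (n.+1%:R * h))| <= w /\
    `|V c - V (n.+1%:R * h - h)| <= w.
  rewrite nE => /andP[c1 c2]; have cE : 0 <= c <= t by apply/andP; split; lra.
  split.
    have [] // := osc c (n.+1%:R * h) cE n1t.
    by rewrite ler_norml; apply/andP; split; lra.
  have [] // := osc c (n%:R * h) cE; first by rewrite nh nh0.
  by rewrite ler_norml; apply/andP; split; lra.
have step := euler_step_error z L0 hh hn (lE _ n1t) tr osc1.
rewrite nE in step.
apply: le_trans (IH _ nh) _; rewrite exprSr -[leRHS]mulrA.
apply: ler_wpM2l; first by rewrite exprn_ge0 ?(le_trans ler01 A1).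
apply: le_trans (lerD step (lexx _)) _.
rewrite [leRHS]mulrDr -addrA lerD2l.
have -> : 3 * h * w + 3 * (n%:R * h) * w = 3 * (n.+1%:R * h) * w by rewrite -natr1;
  ring.
by rewrite ler_peMl// mulr_ge0// mulr_ge0// mulr_ge0 ?(ltW h0).
Qed.

(** Uniform continuity of the force and of the velocity along the exact trajectory
    makes w small with h, while the amplification factor is at most
    exp (t (1 + 2 L)). *)
Lemma backward_euler_cvg {R : realType} (E : R -> R -> R) (L t : R) (X V : R -> R) :
  0 < t -> 0 <= L -> (forall s, 0 <= s <= t -> lip_with L (E s)) ->
  trajectory E t X V -> {within `[0, t], continuous (fun s => E s (X s))} ->
  backward_euler E (t / n.+1%:R) n.+1 (X t, V t) @[n --> \oo] --> (X 0, V 0).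
Proof.
move=> t0 L0 lE tr cEX; apply/cvgrPdist_le => e e0.
pose A := expR (t * (1 + 2 * L)).
have A0 : 0 < A by exact: expR_gt0.
(* the accumulated error is at most A * (3 * t * w) = e *)
pose w := e / (3 * t * A).
have w0 : 0 < w by rewrite divr_gt0// !mulr_gt0.
have [d1 d10 h1] := segment_unif_continuous cEX w0.
have [_ cV _] := tr; have [d2 d20 h2] := segment_unif_continuous cV w0.
have m0 : 0 < Num.min (Num.min d1 d2) 1 / t by rewrite divr_gt0// !lt_min d10 d20 ltr01.
near=> n.
pose h := t / n.+1%:R.
have h0 : 0 < h by rewrite divr_gt0.
have : h < Num.min (Num.min d1 d2) 1.
  rewrite /h mulrC -ltr_pdivlMr//.
  by near: n; exact: (near_infty_natSinv_lt (PosNum m0)).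
rewrite !lt_min => /andP[/andP[/ltW hd1 /ltW hd2] /ltW hle1].
have nh : n.+1%:R * h = t by rewrite /h mulrC divfK// pnatr_eq0.
have osc c s : 0 <= c <= t -> 0 <= s <= t -> `|c - s| <= h ->
     `|E c (X c) - E s (X s)| <= w /\ `|V c - V s| <= w.
  move=> ct st cs; split; first by apply: h1 => //; exact: le_trans hd1.
  by apply: h2 => //; exact: le_trans hd2.
have hh : 0 < h <= 1 by rewrite h0.
have nht : n.+1%:R * h <= t by rewrite nh.
have := backward_euler_error (X t, V t) L0 hh nht lE tr osc.
rewrite nh /= !subrr normr0 !add0r -/(h) => err.
rewrite prod_normE/= ge_max; set b := euler_step _ _ _ in err *.
set z := backward_euler _ _ _ _ in err *.
have {}err : `|z.1 - X 0| + `|z.2 - V 0| <= e.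
  apply: le_trans err _.
  have -> : e = A * (3 * t * w).
    by rewrite /w; field; rewrite !gt_eqF.
  apply: ler_wpM2r; first by apply: ltW; apply: mulr_gt0 w0; exact: mulr_gt0.
  rewrite /A -nh -mulrA expRM_natl; apply: lerXn2r; rewrite ?nnegrE ?expR_ge0//;
    last exact: expR_ge1Dx.
  by rewrite addr_ge0// mulr_ge0 ?(ltW h0)// addr_ge0// mulr_ge0.
rewrite !(distrC (X 0)) !(distrC (V 0)).
by apply/andP; split; apply: le_trans err; [rewrite lerDl|rewrite lerDr].
Unshelve. all: by end_near. Qed.

Lemma periodic_kick {R : realType} (e : R -> R) (G : R * R -> R) :
  periodic e 1 -> periodic_x G -> periodic_x (G \o kick e).
Proof.
move=> pe pG [x v]; rewrite /= /kick/= -[RHS]pG; congr G.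
by rewrite /= pe; congr pair; rewrite /= !addr0.
Qed.

Lemma periodic_drift {R : realType} (h : R) (G : R * R -> R) :
  periodic_x G -> periodic_x (G \o drift h).
Proof.
move=> pG [x v]; rewrite /= /drift/= -[RHS]pG; congr G.
by congr pair; rewrite /= !addr0// addrAC.
Qed.

Lemma backward_euler_invariance {R : realType} (E : R -> R -> R) (h : R) (n : nat)
  (G : R * R -> R) :
  0 <= h -> (forall s, 0 <= s -> continuous (E s)) ->
    (forall s, 0 <= s -> periodic (E s) 1) ->
  continuous G -> periodic_x G -> (forall z, 0 <= G z) ->
  continuous (fun z => G (backward_euler E h n z)) /\
  periodic_x (fun z => G (backward_euler E h n z)) /\
  (\int[leb2]_(z in cylinder) (G (backward_euler E h n z))%:E =
    \int[leb2]_(z in cylinder) (G z)%:E)%E.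
Proof.
move=> h0 cE pE cG pG G0; elim: n => [//|n [cn [pn <-]]] /=.
have s0 : 0 <= n.+1%:R * h by rewrite mulr_ge0.
pose e x := h * E (n.+1%:R * h) x.
have ce : continuous e.
  by apply: (continuous_compose (cE _ s0)); exact: mulrl_continuous.
have pe : periodic e 1 by move=> x; rewrite /e pE.
pose Gn z := G (backward_euler E h n z).
have cd : continuous (Gn \o drift (- h)).
  by apply: (continuous_compose (@continuous_drift R (- h))).
split; first by apply: (@continuous_compose _ _ _ (kick e) (Gn \o drift (- h))) => //;
  exact: continuous_kick.
split; first exact: (periodic_kick pe (periodic_drift (- h) pn)).
transitivity (\int[leb2]_(z in cylinder) (Gn (drift (- h) z))%:E)%E.
  by apply: (@integral_kick R e (Gn \o drift (- h))) => // z; exact: G0.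
by apply: integral_drift => // z; exact: G0.
Qed.

Lemma trajectory_velocity_bound {R : realType} (E : R -> R -> R) (B t : R)
  (X V : R -> R) :
  0 <= t -> trajectory E t X V -> (forall s x, 0 <= s <= t -> `|E s x| <= B) ->
  `|V t - V 0| <= B * t.
Proof.
rewrite le_eqVlt => /predU1P[<- _ _|t0 tr EB]; first by rewrite subrr normr0 mulr0.
have [_ [c ct ->]] := trajectory_increment tr (lexx 0) t0 (lexx t).
rewrite subr0 normrM (gtr0_norm t0) normrN; apply: ler_wpM2r; first exact: ltW.
exact: EB.
Qed.

(** * Bounds on the electric field *)

Lemma fracpart_periodic {R : realType} : periodic (@fracpart R) 1.
Proof.
move=> x; rewrite /fracpart floorDrz ?int_num1// floor1 intrD.
by rewrite opprD addrACA subrr addr0.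
Qed.

Lemma fracpart_id {R : realType} (x : R) : 0 <= x < 1 -> fracpart x = x.
Proof. by move=> x01; rewrite /fracpart (@floor_def _ x 0) ?subr0// add0r. Qed.

(** Continuity extends the bound on [0, 1[ to the closed period, neighbouring
    periods are glued at their common endpoint, and by periodicity distant points
    can be brought to distance less than 1. *)
Lemma lip_periodic {R : realType} (S : R) (e : R -> R) :
  0 <= S -> continuous e -> periodic e 1 ->
  (forall x y, 0 <= x -> x <= y -> y < 1 -> `|e y - e x| <= S * (y - x)) ->
  lip_with S e.
Proof.
move=> S0 ce pe h.
have h01 x y : 0 <= x -> x <= y -> y <= 1 -> `|e y - e x| <= S * (y - x).
  move=> x0 xy; rewrite le_eqVlt => /predU1P[y1|]; last exact: h.
  move: xy; rewrite y1 le_eqVlt => /predU1P[->|x1];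
    first by rewrite !subrr normr0 mulr0.
  have /cvgrPdist_le cl : e z @[z --> 1^'-] --> e 1 by exact: cvg_at_left_filter (ce 1).
  apply/ler_addgt0Pr => eps eps0.
  have near1 : \forall z \near (1:R)^'-, `|e 1 - e z| <= eps /\ (x <= z /\ z < 1).
    near=> z; split; [near: z|split; near: z].
    - exact: cl.
    - exact: nbhs_left_ge.
    - exact: nbhs_left_lt.
  have pf1 : ProperFilter (1:R)^'- by exact: at_left_proper_filter.
  have [z [ez [xz z1]]] := @filter_ex _ _ pf1 _ near1.
  rewrite -(subrKA (e z)) (le_trans (ler_normD _ _))// addrC lerD//.
  apply: le_trans (h _ _ x0 xz z1) _; rewrite ler_wpM2l// lerD2r ltW//.
have hn (n : int) x y : n%:~R <= x -> x <= y -> y <= n%:~R + 1 ->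
  `|e y - e x| <= S * (y - x).
  move=> nx xy yn.
  rewrite -(periodic_int (- n) y pe) -(periodic_int (- n) x pe) mulrNz.
  have -> : y - x = (y - n%:~R) - (x - n%:~R) by ring.
  by apply: h01; rewrite ?subr_ge0// ?lerD2r// lerBlDl.
have h1 x y : x <= y -> y < x + 1 -> `|e y - e x| <= S * (y - x).
  move=> xy yx.
  have fx := floor_le x; have xf := floorD1_gt x; rewrite intrD mulr1z in xf.
  have [yn|ny] := leP y ((Num.floor x)%:~R + 1).
    by apply: (hn (Num.floor x)).
  rewrite -(subrKA (e ((Num.floor x)%:~R + 1))) (le_trans (ler_normD _ _))//.
  have -> : S * (y - x) = S * (y - ((Num.floor x)%:~R + 1))
    + S * ((Num.floor x)%:~R + 1 - x) by ring.
  apply: lerD.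
    by apply: (hn (Num.floor x + 1)); rewrite ?intrD ?mulr1z; lra.
  by apply: (hn (Num.floor x)) => //; lra.
have hxy x y : x <= y -> `|e y - e x| <= S * (y - x).
  move=> xy; have /andP[r0 r1] := fracpart_itv (y - x).
  have -> : e y = e (x + fracpart (y - x)).
    rewrite -[RHS](periodic_int (Num.floor (y - x)) _ pe) /fracpart; congr e.
    by rewrite -addrA subrK addrC subrK.
  apply: (@le_trans _ _ (S * (x + fracpart (y - x) - x))).
    by apply: h1; rewrite ?lerDl// ltrD2l.
  rewrite ler_wpM2l// addrAC subrr add0r /fracpart gerBl ler0z floor_ge_int.
  by rewrite subr_ge0.
move=> x y; have [xy|/ltW yx] := leP x y.
  by rewrite distrC (distrC x) (ger0_norm (_ : 0 <= y - x)) ?subr_ge0//; exact: hxy.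
by rewrite (ger0_norm (_ : 0 <= x - y)) ?subr_ge0//; exact: hxy.
Unshelve. all: by end_near. Qed.

Definition density {R : realType} (F : R * R -> R) (y : R) : R :=
  (\int[leb]_(v in setT) F (y, v))%R.

Lemma le_norm_fine {R : realType} (x : \bar R) : (`|fine x|%:E <= `|x|)%E.
Proof. by case: x => [r| |] //=; rewrite ?normr0 ?leey. Qed.

Lemma integrable_fine {d} {T : measurableType d} {R : realType}
    (mu : {measure set T -> \bar R}) (D : set T) (f : T -> \bar R) :
  measurable D -> mu.-integrable D f -> mu.-integrable D (fun x => (fine (f x))%:E).
Proof.
move=> mD intf; apply: (le_integrable mD _ _ intf).
  apply/measurable_EFinP; apply: (@measurableT_comp _ _ _ _ _ _ fine) => //.
  exact: measurable_int intf.
by move=> x _; exact: le_norm_fine.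
Qed.

(** Fubini's theorem, applied to the extension of F by zero: F is only known to be
    measurable on the cylinder. *)
Lemma integrable_density {R : realType} (F : R * R -> R) (N : R) :
  leb2.-integrable cylinder (EFin \o F) ->
  (\int[leb2]_(z in cylinder) `|F z|%:E <= N%:E)%E ->
  leb.-integrable `[0, 1]%classic (EFin \o density F) /\
  (\int[leb]_(y in `[0%R, 1%R]) `|density F y|)%R <= N.
Proof.
move=> iF FN.
have mI : measurable (`[0, 1]%classic : set R) by exact: measurable_itv.
have iG : leb2.-integrable setT ((EFin \o F) \_ cylinder).
  by rewrite -integrable_mkcond//; exact: measurable_cylinder.
have iGF := integrable_fubini_F iG.
have GE y : y \in (`[0, 1]%classic : set R) ->
    (\int[leb]_v (F (y, v))%:E)%E = fubini_F leb ((EFin \o F) \_ cylinder) y.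
  move=> yI; apply: eq_integral => v _.
  by rewrite patchE in_cylinder yI.
have iD : leb.-integrable `[0, 1]%classic (EFin \o density F).
  have : leb.-integrable `[0, 1]%classic
    (fun y => (fine (fubini_F leb ((EFin \o F) \_ cylinder) y))%:E).
    apply/integrable_fine => //; exact: (integrableS measurableT).
  apply: eq_integrable => // y yI; congr EFin; rewrite /density /Rintegral.
  by rewrite GE.
split => //.
rewrite /Rintegral -lee_fin fineK; last first.
  by apply: integrable_fin_num => //; exact: (integrable_norm iD).
apply: le_trans FN.
rewrite integral_cylinder12; last 2 first.
- apply: measurableT_comp => //; apply: measurableT_comp => //.
  by have /measurable_EFinP := measurable_int _ iF.
- by move=> z; rewrite lee_fin.
apply: ge0_le_integral => //.
- have /measurable_EFinP mD := measurable_int _ iD.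
  by apply/measurable_EFinP; exact: measurableT_comp.
- have m1 : measurable_fun (`[0, 1]%classic : set R)
      (fubini_F leb (abse \o ((EFin \o F) \_ cylinder))).
    apply: measurable_funTS; apply: measurable_fun_fubini_tonelli_F.
      by apply: measurableT_comp => //; exact: measurable_int iG.
    by move=> z; exact: abse_ge0.
  apply: eq_measurable_fun m1 => y yI.
  by apply: eq_integral => v _; rewrite /= patchE in_cylinder yI.
- move=> y yI; rewrite /density /Rintegral.
  have yI' : y \in (`[0, 1]%classic : set R) by rewrite inE.
  have mFy : measurable_fun setT (fun v => (F (y, v))%:E).
    have := measurable_fun_pair2 y (measurable_int _ iG).
    apply: eq_measurable_fun => v _.
    by rewrite patchE in_cylinder yI'.
  apply: le_trans (le_norm_fine _) _.
  exact: (le_abse_integral leb measurableT mFy).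
Qed.

Lemma density_bound {R : realType} (F : R * R -> R) (Fm W y : R) :
  leb2.-integrable cylinder (EFin \o F) -> 0 <= y <= 1 -> 0 <= W ->
  (forall v, `|F (y, v)| <= Fm) -> (forall v, W < `|v| -> F (y, v) = 0) ->
  `|density F y| <= 2 * W * Fm.
Proof.
move=> iF y01 W0 FFm FW.
have yI : y \in (`[0, 1]%classic : set R) by rewrite inE /= in_itv.
have mFy : measurable_fun setT (fun v => F (y, v)).
  apply/measurable_EFinP.
  have iG : leb2.-integrable setT ((EFin \o F) \_ cylinder).
    by rewrite -integrable_mkcond//; exact: measurable_cylinder.
  have := measurable_fun_pair2 y (measurable_int _ iG).
  by apply: eq_measurable_fun => v _; rewrite patchE in_cylinder yI.
pose I : set R := `[- W, W]%classic.
have mI : measurable I by exact: measurable_itv.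
have muI : leb I = (2 * W)%:E.
  rewrite lebesgue_measure_itv/= lte_fin; case: ifPn => [_|].
    by rewrite -EFinB; congr EFin; ring.
  by rewrite -leNgt => WN; rewrite (_ : W = 0) ?mulr0//; lra.
have muIoo : (leb I < +oo)%E by rewrite muI ltry.
have iI : leb.-integrable I (EFin \o (fun v => F (y, v))).
  by apply: (@bounded_integrable _ _ _ _ _ _ Fm) => //; exact: measurable_funTS.
have -> : density F y = (\int[leb]_(v in I) F (y, v))%R.
  rewrite /density [RHS]Rintegral_mkcond; apply: eq_Rintegral => v _.
  rewrite patchE; case: ifPn => // /negP vI; apply: FW; rewrite ltNge; apply/negP => h.
  by apply: vI; rewrite inE /I /= in_itv/= -ler_norml.
have nI := (fun m => le_normr_Rintegral m iI) mI; apply: (le_trans nI).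
apply: (@le_trans _ _ (\int[leb]_(v in I) Fm)%R).
  apply: le_Rintegral => //; first exact: (integrable_norm iI).
  exact: (@bounded_integrable _ _ _ _ _ _ `|Fm|).
rewrite Rintegral_cst// (_ : fine _ = 2 * W); last exact: (congr1 fine muI).
by rewrite mulrC.
Qed.

Lemma K_bound {R : realType} (x y : R) : 0 <= y <= 1 -> `|K x y| <= 1.
Proof. by move=> /andP[y0 y1]; rewrite /K ler_norml; case: ifP => _; lra. Qed.

Lemma measurable_K {R : realType} (x : R) : measurable_fun setT (K x).
Proof.
apply: measurable_fun_ifT => //; last by apply: measurable_funB.
exact: measurable_fun_ltr.
Qed.

Lemma integrable_field_integrand {R : realType} (rho : R -> R) (D : R -> R) (Mr x : R) :
  measurable_fun setT rho -> (forall y, `|rho y| <= Mr) ->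
  leb.-integrable `[0, 1]%classic (EFin \o D) ->
  leb.-integrable `[0, 1]%classic (EFin \o (fun y => K x y * (rho y - D y))).
Proof.
move=> mr rM iD.
have mI : measurable (`[0, 1]%classic : set (measurableTypeR R))
  by exact: measurable_itv.
have muI : (leb (`[0%R, 1%R]%classic : set R) < +oo)%E.
  by rewrite lebesgue_measure_itv/=; case: ifP => _; rewrite ?ltry.
have ir : leb.-integrable `[0, 1]%classic (EFin \o rho).
  by apply: (@bounded_integrable _ _ _ _ _ _ Mr) => //; exact: measurable_funTS.
have isum : leb.-integrable `[0, 1]%classic (EFin \o (fun y => rho y - D y)).
  by apply: eq_integrable (integrableB mI ir iD).
apply: (le_integrable mI _ _ isum).
  apply/measurable_EFinP; apply: measurable_funM.
    by apply: measurable_funTS; exact: measurable_K.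
  by have /measurable_EFinP := measurable_int _ isum.
move=> y; rewrite /= in_itv/= => yI.
by rewrite lee_fin normrM ler_piMl// K_bound.
Qed.

(** The kernel K is bounded by 1. *)
Lemma efield_bound {R : realType} (rho : R -> R) (f : R -> R * R -> R) (Mr N t x : R) :
  measurable_fun setT rho -> (forall y, `|rho y| <= Mr) ->
  leb2.-integrable cylinder (EFin \o f t) ->
  (\int[leb2]_(z in cylinder) `|f t z|%:E <= N%:E)%E ->
  `|efield rho f t x| <= Mr + N.
Proof.
move=> mr rM iF FN.
have [iD DN] := integrable_density iF FN.
have mI : measurable (`[0, 1]%classic : set (measurableTypeR R))
  by exact: measurable_itv.
have muI : leb (`[0%R, 1%R]%classic : set R) = 1%E.
  by rewrite lebesgue_measure_itv/= lte_fin ltr01 sube0.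
have muIoo : (leb (`[0%R, 1%R]%classic : set R) < +oo)%E by rewrite muI ltry.
have iK := integrable_field_integrand (fracpart x) mr rM iD.
have iM : leb.-integrable `[0, 1]%classic (EFin \o (fun=> Mr)).
  exact: (@bounded_integrable _ _ _ _ _ _ `|Mr|).
have iN := integrable_norm iD.
have nI := (fun m => le_normr_Rintegral m iK) mI; apply: (le_trans nI).
apply: (@le_trans _ _ (\int[leb]_(y in `[0%R, 1%R]) (Mr + `|density (f t) y|))%R).
  apply: le_Rintegral => //; first exact: (integrable_norm iK).
    by apply: eq_integrable (integrableD mI iM iN).
  move=> y; rewrite /= in_itv/= => yI.
  rewrite normrM; apply: (@le_trans _ _ `|rho y - density (f t) y|).
    by rewrite ler_piMl// K_bound.
  by apply: le_trans (ler_normB _ _) _; rewrite lerD2r.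
rewrite RintegralD// Rintegral_cst// (_ : fine _ = 1) ?mulr1;
  last exact: (congr1 fine muI).
by rewrite lerD2l.
Qed.

(** On [0, 1] the function K x' - K x is the indicator of ]x, x']: this is the
    equation d_x E = rho - density in integrated form. *)
Lemma efield_increment {R : realType} (rho : R -> R) (f : R -> R * R -> R)
  (Mr D t x x' : R) :
  measurable_fun setT rho -> (forall y, `|rho y| <= Mr) ->
  leb2.-integrable cylinder (EFin \o f t) ->
  (forall y, 0 <= y <= 1 -> `|density (f t) y| <= D) ->
  0 <= x -> x <= x' -> x' < 1 ->
  `|efield rho f t x' - efield rho f t x| <= (Mr + D) * (x' - x).
Proof.
move=> mr rM iF DD x0 xx' x1.
have intN : (\int[leb2]_(z in cylinder) `|f t z|%:E <=
    (fine (\int[leb2]_(z in cylinder) `|f t z|%:E)%E)%:E)%E.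
  rewrite fineK//; apply: integrable_fin_num; first exact: measurable_cylinder.
  exact: (integrable_norm iF).
have [iD _] := integrable_density iF intN.
have mI : measurable (`[0, 1]%classic : set (measurableTypeR R))
  by exact: measurable_itv.
have S0 : 0 <= Mr + D.
  by rewrite addr_ge0// ?(le_trans _ (rM 0))// (le_trans _ (DD 0 _))// lexx ler01.
rewrite /efield !fracpart_id ?x0 ?x1 ?(le_trans x0 xx') ?(le_lt_trans xx' x1)//.
rewrite -RintegralB//; [|exact: integrable_field_integrand mr rM iD..].
have iB := integrableB mI (integrable_field_integrand x' mr rM iD)
  (integrable_field_integrand x mr rM iD).
have iB' : leb.-integrable `[0, 1]%classic
  (EFin \o (fun y => K x' y * (rho y - density (f t) y)
    - K x y * (rho y - density (f t) y))).
  by apply: eq_integrable iB.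
have nI := (fun m => le_normr_Rintegral m iB') mI; apply: (le_trans nI).
apply: (@le_trans _ _ (\int[leb]_(y in `[0%R, 1%R]) ((Mr + D) * \1_(`]x, x']%classic :
  set R) y))%R).
  apply: le_Rintegral => //; first exact: (integrable_norm iB').
    apply: eq_integrable (integrableZl mI (Mr + D)
      (integrableS measurableT mI _ (integrable_indic_itv x x' false false))) => //.
  move=> y; rewrite /= in_itv/= => yI.
  rewrite -mulrBl normrM mulrC; apply: ler_pM => //.
    by apply: le_trans (ler_normB _ _) _; apply: lerD => //; exact: DD.
  rewrite /K indicE; case: (ltP x y) => xy; case: (ltP x' y) => x'y.
  - by rewrite subrr normr0.
  - rewrite mem_set/=; last by rewrite in_itv/= xy.
    by rewrite opprB addrC subrK normr1.
  - by move: (le_lt_trans xx' x'y); rewrite ltNge xy.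
  - by rewrite subrr normr0.
rewrite RintegralZl//; last first.
  exact: (integrableS measurableT mI _ (integrable_indic_itv x x' false false)).
rewrite ler_wpM2l// /Rintegral integral_indic//.
rewrite (setIidl _); last first.
  move=> y /=; rewrite !in_itv/= => /andP[h1 h2]; apply/andP; split; lra.
suff E : leb `]x, x']%classic = (x' - x)%:E by rewrite (_ : fine _ = x' - x)//;
  exact: (congr1 fine E).
rewrite lebesgue_measure_itv/= lte_fin; case: ltP => // xa.
by rewrite (@le_anti _ _ x x') ?xx'// subrr.
Qed.

(** * Periodic functions with compact support in velocity *)

Lemma within_continuous_compose {S T U : topologicalType} (A : set T) (B : set S)
    (g : T -> U) (h : S -> T) :
  {within A, continuous g} -> {within B, continuous h} ->
  (forall s, B s -> A (h s)) -> {within B, continuous (fun s => g (h s))}.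
Proof.
move=> /subspace_continuousP cg /subspace_continuousP ch BA.
apply/subspace_continuousP => s Bs.
apply: cvg_trans (cg _ (BA _ Bs)) => P.
move=> nP; have := ch _ Bs _ nP.
rewrite /= /nbhs/= /within/=; apply: filterS => y hy By.
by apply: hy => //; exact: BA.
Qed.

Lemma continuous_periodic_slab {R : realType} (E : R -> R -> R) (t : R) :
  {within [set p : R * R | 0 <= p.1], continuous (fun p : R * R => E p.1 p.2)} ->
  (forall s, periodic (E s) 1) ->
  exists2 B : R, 0 <= B & forall s x, 0 <= s <= t -> `|E s x| <= B.
Proof.
move=> cE pE.
pose A : set (R * R) := `[0, t]%classic `*` `[0, 1]%classic.
have cA : compact A by apply: compact_setX; exact: segment_compact.
have : compact ((fun p => E p.1 p.2) @` A).
  apply: continuous_compact => //; apply: continuous_subspaceW cE.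
  by move=> p [] /=; rewrite in_itv/= => /andP[].
move=> /compact_bounded [M [_ hM]].
exists (`|M| + 1) => [|s x st]; first by rewrite addr_ge0.
rewrite -(periodic_fracpart x (pE s)).
apply: (hM (`|M| + 1)); first by rewrite ltr_pwDr// ler_norm.
exists (s, fracpart x) => //; have /andP[r0 /ltW r1] := fracpart_itv x.
by split; rewrite /= in_itv/= ?r0.
Qed.

Lemma periodic_supported_bounded {R : realType} (M : R) (h : R * R -> R) :
  continuous h -> periodic_x h -> (forall x v, M < `|v| -> h (x, v) = 0) ->
  exists2 C : R, 0 <= C & forall z, `|h z| <= C.
Proof.
move=> ch ph h0.
pose A : set (R * R) := `[0, 1]%classic `*` `[- M, M]%classic.
have cA : compact A by apply: compact_setX; exact: segment_compact.
have [C C0 hC] := continuous_bounded_on_compact ch cA.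
exists C => [|[x v]]; first exact: ltW.
have ps : periodic (fun x => h (x, v)) 1.
  by move=> y; rewrite -[RHS]ph; congr h; congr pair; rewrite /= addr0.
rewrite -(periodic_fracpart x ps).
have [vM|Mv] := leP `|v| M; last by rewrite h0// normr0 ltW.
apply: hC; have /andP[r0 /ltW r1] := fracpart_itv x.
by split; rewrite /= in_itv/= ?r0// -ler_norml.
Qed.

(** By periodicity in x and compactness of the support in v, f0 and its partial
    derivatives are bounded by their maxima over a rectangle. *)
Lemma smooth_periodic_lip {R : realType} (f0 : R * R -> R) :
  smooth f0 -> periodic_x f0 -> compactly_supported_v f0 ->
  exists M Fm Lam : R, [/\ 0 <= M, 0 <= Fm & 0 <= Lam] /\
    [/\ continuous f0, (forall x v, M < `|v| -> f0 (x, v) = 0),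
        (forall z, `|f0 z| <= Fm) &
        forall z w, `|f0 z - f0 w| <= Lam * (`|z.1 - w.1| + `|z.2 - w.2|)].
Proof.
move=> sm pf [M fM].
have [cf df] := sm [::].
have cD w : continuous ('D_w f0) by have [] := sm [:: w].
have pD w : periodic_x ('D_w f0).
  move=> z; rewrite /derive; congr (lim (_ @ 0^')).
  apply/funext => h /=; rewrite pf; congr (_ *: (_ - _)).
  by rewrite addrA pf.
have D0 w x v : M < `|v| -> 'D_w f0 (x, v) = 0.
  move=> Mv; rewrite -(@derive_cst R (R * R)%type R 0 (x, v) w).
  apply: near_eq_derive; near=> z; rewrite [z]surjective_pairing fM//.
  near: z; apply: (cvgr_norm_gt (f := snd) v) => //; exact: cvg_snd.
have [F F0 hF] := periodic_supported_bounded cf pf fM.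
have [C1 C10 hC1] := periodic_supported_bounded (cD (1, 0)) (pD (1, 0)) (D0 (1, 0)).
have [C2 C20 hC2] := periodic_supported_bounded (cD (0, 1)) (pD (0, 1)) (D0 (0, 1)).
have l1 v : lip_with C1 (fun x => f0 (x, v)).
  have ds (x : R) : is_derive x (1 : R) (fun x : R => f0 (x, v)) ('D_(1, 0) f0 (x, v)).
    by apply: is_derive_slice1; exact: df.
  apply: derive_bound_lip => x; first by have [] := ds x.
  by have [_ ->] := ds x.
have l2 x : lip_with C2 (fun v => f0 (x, v)).
  have ds (v : R) : is_derive v (1 : R) (fun v : R => f0 (x, v)) ('D_(0, 1) f0 (x, v)).
    by apply: is_derive_slice2; exact: df.
  apply: derive_bound_lip => v; first by have [] := ds v.
  by have [_ ->] := ds v.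
exists `|M|, F, (C1 + C2); split; first by split => //; exact: addr_ge0.
split => //; first by move=> x v h; apply: fM; apply: le_lt_trans (ler_norm _) h.
move=> [x v] [y w] /=.
rewrite -(subrKA (f0 (y, v))) (le_trans (ler_normD _ _))//.
rewrite mulrDr; apply: lerD.
  by apply: le_trans (l1 v x y) _; rewrite ler_wpM2r// lerDl.
by apply: le_trans (l2 y v w) _; rewrite ler_wpM2r// lerDr.
Unshelve. all: by end_near. Qed.

Lemma slice_lip_continuous {R : realType} (L : R) (u : R * R -> R) :
  (forall v, lip_with L (fun x => u (x, v))) ->
  (forall x, lip_with L (fun v => u (x, v))) -> continuous u.
Proof.
move=> l1 l2 [x v]; apply/cvgrPdist_le => e e0.
have L0 := lip_with_ge0 (l1 0).
have d0 : 0 < e / (2 * (L + 1)) by rewrite divr_gt0// mulr_gt0// ltr_wpDl.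
have main y w : `|x - y| <= e / (2 * (L + 1)) -> `|v - w| <= e / (2 * (L + 1)) ->
    `|u (x, v) - u (y, w)| <= e.
  move=> zx zv; rewrite -(subrKA (u (y, v))) (le_trans (ler_normD _ _))//.
  apply: le_trans (lerD (l1 v x y) (l2 y v w)) _.
  have -> : e = (L + 1) * (e / (2 * (L + 1))) + (L + 1) * (e / (2 * (L + 1))).
    by field; rewrite gt_eqF// ltr_wpDl.
  by apply: lerD; apply: ler_pM => //; rewrite lerDl.
have /cvgrPdist_le c1 : fst p @[p --> (x, v)] --> x by exact: cvg_fst.
have /cvgrPdist_le c2 : snd p @[p --> (x, v)] --> v by exact: cvg_snd.
near=> z; rewrite [z]surjective_pairing; apply: main.
  by near: z; exact: c1.
by near: z; exact: c2.
Unshelve. all: by end_near. Qed.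

(** * Transport along characteristics *)

(** The values of f at time t are carried from time 0 by characteristics.  All the
    estimates of f t only need a trajectory through each point, not the flow. *)
Definition transported {R : realType} (E : R -> R -> R) (f : R -> R * R -> R) (t : R) :
  Prop :=
  forall z, exists X V : R -> R,
    [/\ trajectory E t X V, (X t, V t) = z & f t z = f 0 (X 0, V 0)].

Lemma vp_transported {R : realType} (rho : R -> R) (f : R -> R * R -> R) (t : R) :
  vp_solution rho f -> 0 <= t -> transported (efield rho f) f t.
Proof.
move=> sol t0 z; have [Phi [Psi [[Phi0 cPhi dPhi] PP]]] := vp_transport sol.
have [_ PsiK ->] := PP _ t0.
exists (fun s => (Phi s (Psi t z)).1), (fun s => (Phi s (Psi t z)).2); split.
- have sub : `[0, t]%classic `<=` [set s : R | 0 <= s].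
    by move=> s /=; rewrite in_itv/= => /andP[].
  have c := continuous_subspaceW sub (cPhi (Psi t z)).
  split.
  + by move=> s; apply: (@cvg_comp _ _ _ _ fst _ _ _ (c s)); exact: continuous_fst.
  + by move=> s; apply: (@cvg_comp _ _ _ _ snd _ _ _ (c s)); exact: continuous_snd.
  + by move=> s /andP[s0 _]; exact: dPhi.
- by rewrite -surjective_pairing PsiK.
- by rewrite Phi0 -surjective_pairing.
Qed.

Lemma transported_bounded {R : realType} (E : R -> R -> R) (f : R -> R * R -> R)
  (t Fm : R) :
  transported E f t -> (forall z, `|f 0 z| <= Fm) -> forall z, `|f t z| <= Fm.
Proof. by move=> tr fF z; have [X [V [_ _ ->]]] := tr z. Qed.

Lemma transported_support {R : realType} (E : R -> R -> R) (f : R -> R * R -> R)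
  (t M B : R) :
  0 <= t -> transported E f t -> (forall s x, 0 <= s <= t -> `|E s x| <= B) ->
  (forall x v, M < `|v| -> f 0 (x, v) = 0) ->
  forall x v, M + B * t < `|v| -> f t (x, v) = 0.
Proof.
move=> t0 tr EB f0 x v h; have [X [V [XV [xE vE] ->]]] := tr (x, v).
have := trajectory_velocity_bound t0 XV EB; rewrite vE => vV; apply: f0.
have : `|v| <= `|v - V 0| + `|V 0| by rewrite -{1}(subrK (V 0) v) ler_normD.
lra.
Qed.

Lemma transported_lip {R : realType} (E : R -> R -> R) (f : R -> R * R -> R)
  (L Lam t : R) :
  0 <= t -> 0 <= L -> 0 <= Lam -> (forall s, 0 <= s <= t -> lip_with L (E s)) ->
  transported E f t ->
  (forall z w, `|f 0 z - f 0 w| <= Lam * (`|z.1 - w.1| + `|z.2 - w.2|)) ->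
  (forall v, lip_with (2 * Lam * expR ((1 + L) * t)) (fun x => f t (x, v))) /\
  (forall x, lip_with (2 * Lam * expR ((1 + L) * t)) (fun v => f t (x, v))).
Proof.
move=> t0 L0 Lam0 lE tr lf.
have K1 : 1 <= expR ((1 + L) * t).
  by rewrite -expR0 ler_expR mulr_ge0// addr_ge0.
set K := expR _ in K1 *.
(* d is the distance of two points on a line parallel to an axis *)
have main z w d : (z.1 - w.1) ^+ 2 + (z.2 - w.2) ^+ 2 = d ^+ 2 ->
    `|f t z - f t w| <= 2 * Lam * K * `|d|.
  move=> zw; have [X [V [XV zE ->]]] := tr z; have [Y [W [YW wE ->]]] := tr w.
  have G : (X 0 - Y 0) ^+ 2 + (V 0 - W 0) ^+ 2 <= d ^+ 2 * K.
    rewrite -zw -zE -wE /=.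
    have [t00|t1] := eqVneq t 0; last first.
      have t2 : 0 < t by rewrite lt_neqAle eq_sym t1.
      exact: (trajectory_gronwall t2 L0 lE XV YW).
    by rewrite t00 ler_peMr// addr_ge0// sqr_ge0.
  apply: le_trans (lf _ _) _ => /=.
  have K0 : 0 <= K by exact: expR_ge0.
  (* K replaces its square root, as 1 <= K *)
  have dK a b : a ^+ 2 + b ^+ 2 <= d ^+ 2 * K -> `|a| <= K * `|d|.
    move=> h; rewrite -[leRHS]ger0_norm ?mulr_ge0// -(ler_sqr (x := `|a|)) ?nnegrE//.
    rewrite !real_normK ?num_real// exprMn real_normK ?num_real//.
    have := sqr_ge0 b; have := sqr_ge0 d; nra.
  have h1 := dK _ _ G; rewrite addrC in G; have h2 := dK _ _ G.
  nra.
split=> [v x y|x v w].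
  by apply: main; rewrite /= subrr expr0n addr0.
by apply: main; rewrite /= subrr expr0n add0r.
Qed.

(** The integral of |f 0| along the backward Euler scheme does not depend on the
    number of steps, and the scheme converges pointwise to the backward flow, so
    Fatou's lemma applies. *)
Lemma transported_L1 {R : realType} (E : R -> R -> R) (f : R -> R * R -> R) (L t : R) :
  0 <= t -> 0 <= L -> (forall s, 0 <= s <= t -> lip_with L (E s)) ->
  {within [set p : R * R | 0 <= p.1], continuous (fun p : R * R => E p.1 p.2)} ->
  (forall s, 0 <= s -> continuous (E s)) -> (forall s, 0 <= s -> periodic (E s) 1) ->
  transported E f t -> continuous (f 0) -> periodic_x (f 0) ->
  (\int[leb2]_(z in cylinder) `|f t z|%:E <= \int[leb2]_(z in cylinder) `|f 0 z|%:E)%E.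
Proof.
move=> + L0 lE cE cEs pEs tr cf pf; rewrite le_eqVlt => /predU1P[<-//|t0].
pose G z : R := `|f 0 z|.
have cG : continuous G.
  by apply: (continuous_compose cf); exact: norm_continuous.
have pG : periodic_x G by move=> z; rewrite /G pf.
have G0 z : 0 <= G z by exact: normr_ge0.
pose u n z := (G (backward_euler E (t / n.+1%:R) n.+1 z))%:E.
have hn n : 0 <= t / n.+1%:R :> R by rewrite divr_ge0// ltW.
have inv n := @backward_euler_invariance R E (t / n.+1%:R) n.+1 G (hn n)
  cEs pEs cG pG G0.
have ucvg z : u n z @[n --> \oo] --> (`|f t z|)%:E.
  have [X [V [XV zE ->]]] := tr z.
  have cEX : {within `[0, t], continuous (fun s => E s (X s))}.
    have cc := @within_continuous_compose R (R * R)%type R [set p : R * R | 0 <= p.1]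
       `[0, t]%classic (fun p : R * R => E p.1 p.2) (fun s => (s, X s)) cE.
    apply: cc.
    - have [cX _ _] := XV; apply/subspace_continuousP => s st.
      apply: (@cvg_pair R R R (within `[0, t]%classic (nbhs s)) (nbhs s) (nbhs (X s))).
        exact: cvg_within.
      exact: ((subspace_continuousP _ X).1 cX s st).
    - by move=> s /=; rewrite in_itv/= => /andP[].
  apply: cvg_EFin; first exact: nearW.
  rewrite -zE; apply: (@cvg_comp _ _ _ _ G _ _ _ (backward_euler_cvg t0 L0 lE XV cEX)).
  exact: cG.
have -> : (\int[leb2]_(z in cylinder) `|f t z|%:E =
    \int[leb2]_(z in cylinder) limn_einf (u ^~ z))%E.
  apply: eq_integral => z _.
  rewrite is_cvg_limn_einfE; last by apply/cvg_ex; exists (`|f t z|)%:E; exact: ucvg.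
  by apply/esym/cvg_lim => //; exact: ucvg.
have mu n : measurable_fun cylinder (u n).
  have [cn _] := inv n.
  have := @measurable_funTS _ _ _ _ cylinder _ (continuous_measurable_plane cn).
  by move/measurable_EFinP.
have u0 n z : cylinder z -> (0 <= u n z)%E by move=> _; rewrite lee_fin.
apply: le_trans (fatou leb2 measurable_cylinder mu u0) _.
set a := (X in (_ <= X)%E).
have -> : (fun n => \int[leb2]_(z in cylinder) u n z)%E = cst a.
  by apply/funext => n; exact: (inv n).2.2.
have ca : cst a n @[n --> \oo] --> a by exact: cvg_cst.
rewrite is_cvg_limn_einfE; last by apply/cvg_ex; exists a.
by rewrite (cvg_lim _ ca).
Qed.

(** * Uniform bounds and the gradient estimate *)

Lemma efield_periodic {R : realType} (rho : R -> R) (f : R -> R * R -> R) (t : R) :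
  periodic (efield rho f t) 1.
Proof. by move=> x; rewrite /efield fracpart_periodic. Qed.

Lemma efield_continuous {R : realType} (rho : R -> R) (f : R -> R * R -> R) (t : R) :
  vp_solution rho f -> 0 <= t -> continuous (efield rho f t).
Proof.
move=> sol t0.
have cc := @within_continuous_compose R (R * R)%type R [set p : R * R | 0 <= p.1]
  setT (fun p : R * R => efield rho f p.1 p.2) (fun x => (t, x))
    (vp_field_continuous sol).
have : {within setT, continuous (efield rho f t)}.
  apply: cc => //; apply: continuous_subspaceT.
  by apply: continuous_pair; [exact: cst_continuous|move=> ?; exact: cvg_id].
exact: (continuous_subspace_setT (efield rho f t)).2.
Qed.

(** Up to time t velocities are at most M + B t, so the density is at most
    2 (M + B t) Fm. *)
Lemma efield_lip {R : realType} (rho : R -> R) (f : R -> R * R -> R) (Mr M Fm B t : R) :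
  vp_solution rho f -> measurable_fun setT rho -> (forall y, `|rho y| <= Mr) ->
  0 <= M -> 0 <= B -> (forall z, `|f 0 z| <= Fm) ->
  (forall x v, M < `|v| -> f 0 (x, v) = 0) ->
  (forall s x, 0 <= s <= t -> `|efield rho f s x| <= B) ->
  forall s, 0 <= s <= t -> lip_with (Mr + 2 * (M + B * t) * Fm) (efield rho f s).
Proof.
move=> sol mr rM M0 B0 fF fM EB s /andP[s0 st].
have Mr0 : 0 <= Mr by apply: le_trans (rM 0).
have Fm0 : 0 <= Fm by apply: le_trans (fF (0, 0)).
have t0 : 0 <= t by exact: le_trans st.
have tr := vp_transported sol s0.
have W0 : 0 <= M + B * t by rewrite addr_ge0// mulr_ge0.
have sup x v : M + B * t < `|v| -> f s (x, v) = 0.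
  move=> h; apply: (transported_support s0 tr _ fM (B := B)).
    by move=> r y /andP[r0 rs]; apply: EB; rewrite r0 (le_trans rs).
  by apply: le_lt_trans h; rewrite lerD2l ler_wpM2l.
have fsF := transported_bounded tr fF.
apply: lip_periodic.
- by rewrite addr_ge0// !mulr_ge0.
- exact: efield_continuous.
- exact: efield_periodic.
- move=> x y x0 xy y1.
  apply: (efield_increment mr rM (vp_integrable sol s0)) => // w w01.
  apply: (density_bound (vp_integrable sol s0) w01 W0) => // v; exact: sup.
Qed.

(** A bound of E over [0, t], of unknown size, follows from compactness and makes E
    Lipschitz in x.  This suffices for the L^1 norm of f t not to exceed that of
    f 0, and the resulting bound of E does not depend on t. *)
Lemma efield_apriori_bound {R : realType} (rho : R -> R) (f : R -> R * R -> R)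
  (Mr M Fm : R) :
  vp_solution rho f -> measurable_fun setT rho -> (forall y, `|rho y| <= Mr) ->
  0 <= M -> continuous (f 0) -> periodic_x (f 0) -> (forall z, `|f 0 z| <= Fm) ->
  (forall x v, M < `|v| -> f 0 (x, v) = 0) ->
  forall t x, 0 <= t ->
    `|efield rho f t x| <= Mr + fine (\int[leb2]_(z in cylinder) `|f 0 z|%:E)%E.
Proof.
move=> sol mr rM M0 cf pf fF fM t x t0.
have Mr0 : 0 <= Mr by apply: le_trans (rM 0).
have Fm0 : 0 <= Fm by apply: le_trans (fF (0, 0)).
have cE := vp_field_continuous sol.
have [B B0 EB] := continuous_periodic_slab t cE (efield_periodic rho f).
have lE := efield_lip sol mr rM M0 B0 fF fM EB.
have tt : 0 <= t <= t by rewrite t0 lexx.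
have L0 := lip_with_ge0 (lE t tt).
apply: (efield_bound _ mr rM (vp_integrable sol t0)).
rewrite fineK.
  apply: (transported_L1 t0 L0 lE cE) => //.
  - by move=> s s0; exact: efield_continuous.
  - by move=> s _; exact: efield_periodic.
  - exact: vp_transported.
apply: integrable_fin_num; first exact: measurable_cylinder.
exact: (integrable_norm (vp_integrable sol (lexx 0))).
Qed.

(** The linear term is absorbed by t <= 1 + t^2. *)
Lemma quadratic_exp_bound {R : realType} (P a b t : R) :
  0 <= P -> 0 <= a -> 0 <= b -> 0 <= t ->
  P * expR (a * t + b * t ^+ 2) <=
  (P * expR a + a + b) * expR ((P * expR a + a + b) * t ^+ 2).
Proof.
move=> P0 a0 b0 t0.
have Pe0 : 0 <= P * expR a by rewrite mulr_ge0// expR_ge0.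
have t20 : 0 <= t ^+ 2 by exact: sqr_ge0.
have tt : t <= 1 + t ^+ 2 by have := sqr_ge0 (t - 1); nra.
apply: (@le_trans _ _ (P * expR a * expR ((a + b) * t ^+ 2))).
  by rewrite -mulrA -expRD ler_wpM2l// ler_expR; nra.
apply: ler_pM => //.
  by rewrite -addrA lerDl addr_ge0.
by rewrite ler_expR ler_wpM2r// -addrA lerDr.
Qed.

Theorem proposition1p1 (R : realType) (rho : R -> R) (f0 : R * R -> R)
  (rho_meas : measurable_fun setT rho)
  (rho_per : periodic rho 1)
  (rho_bounded : exists M : R, forall y, `|rho y| <= M)
  (rho_mass : (\int[leb]_(y in `[0%R, 1%R]) rho y = 1)%R)
  (f0_per : periodic_x f0)
  (f0_smooth : smooth f0)
  (f0_supp : compactly_supported_v f0)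
  (f0_mass : (\int[leb2]_(z in cylinder) f0 z = 1)%R) :
  exists C : R,
    forall f : R -> R * R -> R, vp_solution rho f -> f 0 = f0 ->
    forall t : R, 0 <= t ->
      exists g : R * R -> R * R,
        weak_gradient (f t) g /\
        (Linfty_norm g <= (C * expR (C * t ^+ 2))%:E)%E.
Proof.
have [Mr rM] := rho_bounded.
have Mr0 : 0 <= Mr by apply: le_trans (rM 0).
have [M [Fm [Lam [[M0 Fm0 Lam0] [cf fM fF lf]]]]] :=
  smooth_periodic_lip f0_smooth f0_per f0_supp.
pose N := fine (\int[leb2]_(z in cylinder) `|f0 z|%:E)%E.
have N0 : 0 <= N by apply: fine_ge0; apply: integral_ge0 => z _; rewrite lee_fin.
pose B := Mr + N.
have B0 : 0 <= B by exact: addr_ge0.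
(* a * t + b * t ^+ 2 is (1 + L) * t for the constant L of efield_lip at time t *)
pose a := 1 + Mr + 2 * M * Fm; pose b := 2 * B * Fm.
have a0 : 0 <= a by rewrite !addr_ge0// !mulr_ge0.
have b0 : 0 <= b by rewrite !mulr_ge0.
exists (4 * Lam * expR a + a + b) => f sol f0E t t0; rewrite -f0E in cf fM fF lf f0_per.
have EB s x : 0 <= s <= t -> `|efield rho f s x| <= B.
  move=> /andP[s0 _]; rewrite /B /N -f0E.
  exact: (efield_apriori_bound sol rho_meas rM M0 cf f0_per fF fM).
have lE := efield_lip sol rho_meas rM M0 B0 fF fM EB.
have L0 : 0 <= Mr + 2 * (M + B * t) * Fm.
  by rewrite addr_ge0// !mulr_ge0// addr_ge0// mulr_ge0.
have tr := vp_transported sol t0.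
have [l1 l2] := transported_lip t0 L0 Lam0 lE tr lf.
have ftF := transported_bounded tr fF.
have [g [wg gL]] := lip_weak_gradient (slice_lip_continuous l1 l2) ftF l1 l2.
exists g; split => //; apply: le_trans gL _; rewrite lee_fin.
apply: le_trans (quadratic_exp_bound _ a0 b0 t0); last by rewrite mulr_ge0.
rewrite le_eqVlt; apply/orP; left; apply/eqP.
rewrite (_ : a * t + b * t ^+ 2 = (1 + (Mr + 2 * (M + B * t) * Fm)) * t);
  last by rewrite /a /b; ring.
by ring.
Qed.
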